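(* Let $\pi:E\to M$ be a vector bundle with a vector bundle connection and a translational-invariant metric on the fibers, over a (pseudo-)Riemannian manifold $(M,g)$, and let $\nabla$ be the Levi-Civita connection of the total metric on $E$. If $\tilde w$ is a translational-invariant vector field on $E$ and $v$ is vertical, then $\nabla_v\tilde w$ is horizontal. If additionally the vector bundle connection is metric, then $\nabla_v\tilde w=0$.
   Context: A vector bundle connection on $\pi:E\to M$ is a horizontal distribution $D\subset TE$ (of rank $\dim M$, complementary to the vertical bundle $\ker d\pi$) whose parallel transports along curves are defined everywhere and are linear maps of the fibers. Horizontal means with values in $D$, vertical means with values in $\ker d\pi$. A translational-invariant metric is a (pseudo-)Riemannian metric $h$ on each fiber (regarded as a manifold) invariant under translations of the fiber. The connection is metric if its parallel transports are isometries of the fibers. The total metric $G_{g,h,D}$ on $E$ is the metric for which $D$ is orthogonal to the vertical spaces, which equals $h$ on the fibers, and for which $d\pi|_D$ is a pointwise isometry onto $(TM,g)$. A translational-invariant vector field on $E$ is one of the form $\tilde w$ for a section $w$ of $\pi$, where $\tilde w(e)=\frac{d}{dt}|_{t=0}(e+t\,w(\pi(e)))$. *)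

(* Defs.v *)
From HB Require Import structures.
From mathcomp Require Import all_boot all_order all_algebra.
From mathcomp Require Import all_classical all_reals all_analysis.
Set Implicit Arguments.
Unset Strict Implicit.
Unset Printing Implicit Defensive.
Import Order.TTheory GRing.Theory Num.Theory.
Import numFieldNormedType.Exports.
Local Open Scope classical_set_scope.
Local Open Scope ring_scope.

Section Smoothness.
Context {R : realType} {V W : normedModType R}.

Fixpoint iter_derive (vs : seq V) (f : V -> W) : V -> W :=
  if vs is v :: vs' then 'D_v (iter_derive vs' f) else f.

(* C^oo on a set, meant for open sets: every iterated directional derivative
   is (Frechet) differentiable at every point of U. *)
Definition smooth_on (U : set V) (f : V -> W) : Prop :=
  forall (vs : seq V) (x : V), U x -> differentiable (iter_derive vs f) x.

End Smoothness.

(* A chart of dimension n on the bare set M: cfwd maps cdom injectively onto an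
   open subset of R^n.  Off cdom (resp. off the image) the values of cfwd
   (resp. cbwd) are junk. *)
Record chart (R : realType) (M : Type) (n : nat) := Chart {
  cdom : set M;
  cfwd : M -> 'rV[R]_n;
  cbwd : 'rV[R]_n -> M;
  chart_open : open (cfwd @` cdom);
  chartK : forall p, cdom p -> cbwd (cfwd p) = p }.

Definition chart_compat (R : realType) (M : Type) (n : nat)
    (c d : chart R M n) : Prop :=
  let O := cfwd c @` (cdom c `&` cdom d) in
  open O /\ smooth_on O (cfwd d \o cbwd c).

(* The topology is the one induced by the atlas. *)
Definition atlas_open (R : realType) (M : Type) (n : nat)
    (At : set (chart R M n)) (O : set M) : Prop :=
  forall c, At c -> open (cfwd c @` (cdom c `&` O)).

(* Smooth manifolds without boundary, Hausdorff and second countable.  Given a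
   smooth atlas, second countability of the induced topology amounts to the
   existence of a countable subatlas. *)
Record manifold (R : realType) (M : Type) (n : nat) := Manifold {
  atlas : set (chart R M n);
  atlas_compat : forall c d, atlas c -> atlas d -> chart_compat c d;
  atlas_hausdorff : forall p q, p <> q ->
    exists O O', [/\ atlas_open atlas O, atlas_open atlas O', O p, O' q
                   & O `&` O' = set0];
  atlas_countable : exists At : set (chart R M n),
    [/\ countable At, At `<=` atlas & forall p, exists2 c, At c & cdom c p] }.

(* Tangent vectors are derivations of C^oo(M) at a point (see tangent_space),
   hence functionals on real-valued functions. *)
Definition tvec (R : realType) (M : Type) := (M -> R) -> R^o.

Section Manifolds.
Context {R : realType} {M : Type} {n : nat} (A : manifold R M n).

Definition mopen (O : set M) : Prop := atlas_open (atlas A) O.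

Definition smooth_fun_on (U : set M) (f : M -> R) : Prop :=
  forall c, atlas A c ->
    smooth_on (cfwd c @` (cdom c `&` U)) (f \o cbwd c : 'rV[R]_n -> R^o).

Definition smooth_fun (f : M -> R) : Prop := smooth_fun_on setT f.

(* Smoothness, on an open set U, of a map from a normed space to a manifold;
   the condition F @` J `<=` cdom d on neighbourhoods J of x is continuity. *)
Definition smooth_into (V : normedModType R) (U : set V) (F : V -> M) : Prop :=
  forall x d, U x -> atlas A d -> cdom d (F x) ->
    exists J, [/\ open J, J x, F @` J `<=` cdom d & smooth_on J (cfwd d \o F)].

(* Smoothness on the closed interval [a, b] means smoothness on an open
   neighbourhood of it; outside of it the values of c are junk. *)
Definition smooth_curve (a b : R) (c : R -> M) : Prop :=
  exists I : set R^o, [/\ open I, (forall t : R, a <= t <= b -> I t)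
                        & @smooth_into R^o I c].

(* Functionals are normalized to vanish outside of C^oo(M), so that Leibniz
   equality of tangent vectors is equality of derivations of C^oo(M). *)
Definition tnormalize (v : tvec R M) : tvec R M :=
  fun f => if `[< smooth_fun f >] then v f else 0.

Definition tangent_space (p : M) : set (tvec R M) := [set v : tvec R M |
  [/\ forall (k : R) f g, smooth_fun f -> smooth_fun g ->
        v (fun q => k * f q + g q) = k * v f + v g,
      forall f g, smooth_fun f -> smooth_fun g ->
        v (fun q => f q * g q) = f p * v g + g p * v f
    & forall f, ~ smooth_fun f -> v f = 0]].

Definition velocity (c : R -> M) (t : R) : tvec R M :=
  tnormalize (fun f => derive1 (f \o c : R -> R^o) t).

Definition smooth_vfield_on (U : set M) (X : M -> tvec R M) : Prop :=
  (forall p, U p -> tangent_space p (X p)) /\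
  (forall f, smooth_fun f -> smooth_fun_on U (fun p => X p f)).

Definition smooth_vfield (X : M -> tvec R M) : Prop := smooth_vfield_on setT X.

Definition lie_bracket (X Y : M -> tvec R M) : M -> tvec R M :=
  fun p => tnormalize (fun f => X p (fun q => Y q f) - Y p (fun q => X q f)).

(* Smooth distribution of rank k: near every point there are k smooth vector
   fields whose values form a basis of D. *)
Definition smooth_distribution (k : nat) (D : M -> set (tvec R M)) : Prop :=
  forall p, exists (U : set M) (X : 'I_k -> M -> tvec R M),
    [/\ mopen U, U p, forall i, smooth_vfield_on U (X i)
      & forall q, U q ->
          D q = [set v | exists a : 'I_k -> R, v = \sum_i a i *: X i q] /\
          (forall a : 'I_k -> R, \sum_i a i *: X i q = 0 -> forall i, a i = 0)].

(* A smoothly varying scalar product, symmetric and nondegenerate but of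
   arbitrary signature, on the spaces T p of tangent vectors. *)
Definition metric_on (T : M -> set (tvec R M))
    (g : M -> tvec R M -> tvec R M -> R) : Prop :=
  [/\ forall p x y z (k : R), T p x -> T p y -> T p z ->
        g p (k *: x + y) z = k * g p x z + g p y z,
      forall p x y, T p x -> T p y -> g p x y = g p y x,
      forall p x, T p x -> (forall y, T p y -> g p x y = 0) -> x = 0
    & forall X Y, smooth_vfield X -> smooth_vfield Y ->
        (forall p, T p (X p) /\ T p (Y p)) ->
        smooth_fun (fun p => g p (X p) (Y p))].

Definition pseudo_riemannian (g : M -> tvec R M -> tvec R M -> R) : Prop :=
  metric_on tangent_space g.

(* nab p v X is the covariant derivative of the vector field X along the
   tangent vector v at p. *)
Definition affine_connection
    (nab : M -> tvec R M -> (M -> tvec R M) -> tvec R M) : Prop :=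
  [/\ forall p v X, tangent_space p v -> smooth_vfield X ->
        tangent_space p (nab p v X),
      forall p v w (k : R) X, tangent_space p v -> tangent_space p w ->
        smooth_vfield X -> nab p (k *: v + w) X = k *: nab p v X + nab p w X,
      forall p v X Y, tangent_space p v -> smooth_vfield X -> smooth_vfield Y ->
        nab p v (fun q => X q + Y q) = nab p v X + nab p v Y,
      forall p v f X, tangent_space p v -> smooth_fun f -> smooth_vfield X ->
        nab p v (fun q => f q *: X q) = v f *: X p + f p *: nab p v X
    & forall X Y, smooth_vfield X -> smooth_vfield Y ->
        smooth_vfield (fun p => nab p (X p) Y)].

Definition levi_civita (g : M -> tvec R M -> tvec R M -> R)
    (nab : M -> tvec R M -> (M -> tvec R M) -> tvec R M) : Prop :=
  [/\ affine_connection nab,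
      forall X Y p, smooth_vfield X -> smooth_vfield Y ->
        nab p (X p) Y - nab p (Y p) X = lie_bracket X Y p
    & forall p v X Y, tangent_space p v -> smooth_vfield X -> smooth_vfield Y ->
        v (fun q => g q (X q) (Y q)) = g p (nab p v X) (Y p)
                                       + g p (X p) (nab p v Y)].

End Manifolds.

Definition smooth_map (R : realType) (M N : Type) (m n : nat)
    (A : manifold R M m) (B : manifold R N n) (F : M -> N) : Prop :=
  forall c, atlas A c -> smooth_into B (cfwd c @` cdom c) (F \o cbwd c).

Definition mdifferential (R : realType) (M N : Type) (n : nat)
    (B : manifold R N n) (F : M -> N) (v : tvec R M) : tvec R N :=
  tnormalize B (fun f => v (f \o F)).

Section Bundles.
Context {R : realType} {M : Type} {n r : nat} (F : M -> lmodType R).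

Definition totsp : Type := {p : M & F p}.
Definition bproj (e : totsp) : M := projT1 e.
Definition bpt (p : M) (x : F p) : totsp := existT F p x.

Context (A : manifold R M n) (B : manifold R totsp (n + r)).

(* Local triviality.  The last condition says that Phi is a diffeomorphism
   from the preimage of U onto U x R^r: in the charts of M it yields charts of
   totsp which are compatible with its smooth structure. *)
Definition vector_bundle : Prop :=
  forall p, exists (U : set M) (Phi : forall q, F q -> 'rV[R]_r),
    [/\ mopen A U, U p,
        forall q, U q -> linear (Phi q) /\ bijective (Phi q)
      & forall c, atlas A c -> exists k : chart R totsp (n + r),
          [/\ cdom k = bproj @^-1` (cdom c `&` U),
              forall q (x : F q), (cdom c `&` U) q ->
                cfwd k (bpt x) = row_mx (cfwd c q) (Phi q x)
            & forall d, atlas B d -> chart_compat k d /\ chart_compat d k]].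

Definition dproj : tvec R totsp -> tvec R M := mdifferential A bproj.

Definition vertical (e : totsp) : set (tvec R totsp) :=
  [set v | tangent_space B e v /\ dproj v = 0].

(* The smooth distribution D of rank dim M is complementary to vertical. *)
Definition horizontal_distribution (D : totsp -> set (tvec R totsp)) : Prop :=
  smooth_distribution B n D /\
  (forall e, D e `&` vertical e = [set 0] /\
     tangent_space B e =
       [set v | exists x y, [/\ D e x, vertical e y & v = x + y]]).

(* s is a lift of c by its very type. *)
Definition horizontal_lift (D : totsp -> set (tvec R totsp)) (c : R -> M)
    (a b : R) (s : forall t, F (c t)) : Prop :=
  smooth_curve B a b (fun t => bpt (s t)) /\
  forall t, a <= t <= b -> D (bpt (s t)) (velocity B (fun u => bpt (s u)) t).

Definition parallel_transport (D : totsp -> set (tvec R totsp)) (c : R -> M)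
    (a b : R) (P : F (c a) -> F (c b)) : Prop :=
  forall x, exists s : forall t, F (c t),
    [/\ horizontal_lift D a b s, s a = x & s b = P x].

(* Horizontal lifts with given initial point are unique (D is smooth), so
   that P below is the parallel transport. *)
Definition bundle_connection (D : totsp -> set (tvec R totsp)) : Prop :=
  horizontal_distribution D /\
  forall (c : R -> M) (a b : R), a < b -> smooth_curve A a b c ->
    exists P : F (c a) -> F (c b), parallel_transport D P /\ linear P.

(* Tangent vector at x, in the direction w, to the curve u |-> phi (x + u w)
   of the fiber over q; for phi = id these are the tangent vectors to the
   fibers, and in general it is the image of such a vector under d phi. *)
Definition fiber_velocity (p q : M) (phi : F p -> F q) (x w : F p) :
    tvec R totsp := velocity B (fun u => bpt (phi (x + u *: w))) 0.

Definition fiber_vec (p : M) (x w : F p) : tvec R totsp :=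
  fiber_velocity idfun x w.

Definition fiber_isometry (h : totsp -> tvec R totsp -> tvec R totsp -> R)
    (p q : M) (phi : F p -> F q) : Prop :=
  bijective phi /\
  forall x w1 w2 : F p,
    h (bpt (phi x)) (fiber_velocity phi x w1) (fiber_velocity phi x w2)
    = h (bpt x) (fiber_vec x w1) (fiber_vec x w2).

Definition translation_invariant_metric
    (h : totsp -> tvec R totsp -> tvec R totsp -> R) : Prop :=
  metric_on B vertical h /\
  forall (p : M) (a : F p), fiber_isometry h (fun x : F p => x + a).

Definition metric_connection (D : totsp -> set (tvec R totsp))
    (h : totsp -> tvec R totsp -> tvec R totsp -> R) : Prop :=
  forall (c : R -> M) (a b : R) (P : F (c a) -> F (c b)),
    a < b -> smooth_curve A a b c -> parallel_transport D P ->
    fiber_isometry h P.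

Definition total_metric (g : M -> tvec R M -> tvec R M -> R)
    (h : totsp -> tvec R totsp -> tvec R totsp -> R)
    (D : totsp -> set (tvec R totsp))
    (G : totsp -> tvec R totsp -> tvec R totsp -> R) : Prop :=
  pseudo_riemannian B G /\
  forall e,
    [/\ forall x y, D e x -> vertical e y -> G e x y = 0,
        forall x y, vertical e x -> vertical e y -> G e x y = h e x y
      & forall x y, D e x -> D e y -> G e x y = g (bproj e) (dproj x) (dproj y)].

Definition smooth_section (w : forall p, F p) : Prop :=
  smooth_map A B (fun p => bpt (w p)).

Definition translation_field (w : forall p, F p) : totsp -> tvec R totsp :=
  fun e => fiber_vec (projT2 e) (w (bproj e)).

Definition translation_invariant_field (W : totsp -> tvec R totsp) : Prop :=
  exists2 w : forall p, F p, smooth_section w & W = translation_field w.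

End Bundles.

(* Main.v *)
From HB Require Import structures.
Require Import Defs.
From mathcomp Require Import all_boot all_order all_algebra.
From mathcomp Require Import all_classical all_reals all_analysis.
From mathcomp Require Import ring lra.
Set Implicit Arguments.
Unset Strict Implicit.
Unset Printing Implicit Defensive.
Import Order.TTheory GRing.Theory Num.Theory.
Import numFieldNormedType.Exports.
Local Open Scope classical_set_scope.
Local Open Scope ring_scope.

(** Fix a chart of the total space coming from a local trivialization, with base
coordinates x and fiber coordinates y, and write G(a, b) for the total metric of
two constant coefficient fields a, b. Constant coefficient fields commute, so
Koszul's formula reads
  2 G(nabla_a b, c) = a G(b, c) + b G(a, c) - c G(a, b).
A translation-invariant field w is (0, w(x)); its coefficients vary, but only in
the directions of the base, so it still commutes with the vertical fields
(0, alpha). Exchanging the two fields twice, by vanishing torsion, the derivative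
of w along a vertical vector at a point depends only on the value of w there, and
w may be replaced by a constant coefficient field (0, beta)
([nab_translation_field]).

If a, b, c are vertical, then G is the fiber metric h on them, which is constant
along the fibers by translation invariance; all three terms vanish, so nabla_a b
is orthogonal to the fibers, i.e. horizontal ([nab_vertical_orth],
[orthogonal_horizontal]).

For a metric connection let c = (xi, 0), and let P_t be the parallel transport
along the coordinate line x0 + t xi, with derivative L at t = 0. It is linear,
(xi, L y) is horizontal at (x0, y), and differentiating
h(P_t a, P_t b) = h(a, b) gives c h(a, b) + h(L a, b) + h(a, L b) = 0
([transport_coords]). As (xi, 0) = (xi, L y) - (0, L y), the function G(b, c)
equals - h(b, L y) on the fiber, so a G(b, c) = - h(b, L a), and likewise
b G(a, c) = - h(a, L b). The sum in Koszul's formula is then zero: nabla_a b is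
orthogonal to everything ([nab_metric_orth]).

Three points need care. Transports over different intervals must be compared,
which requires uniqueness of horizontal lifts; for a metric connection it follows
from bijectivity of every transport ([transport_unique]). Tangent vectors are
derivations of global smooth functions, so identifying the vertical ones takes
Hadamard's lemma ([hadamard], [tangent_coordvec]). And fields and functions have
to be global, so local ones are extended by zero with bump functions
([bump_in], [cutoff]). *)

(** * Smooth functions between normed spaces *)

Section DiffUpto.
Context {R : realType}.
Implicit Types V W : normedModType R.

(** Frechet differentiability phrased with an explicit epsilon instead of
   little-o, the form in which derivatives are produced below (germs, means
   along segments). *)
Lemma differentiable_of_bound V W (f : V -> W) (L : {linear V -> W}) x : continuous L ->
  (forall e : R, 0 < e -> \forall h \near (0 : V), `|f (x + h) - f x - L h| <= e * `|h|) ->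
  differentiable f x /\ forall h, 'D_h f x = L h.
Proof.
move=> cL H.
have Ed : f \o shift x = cst (f x) + L +o_ 0 id.
  apply/eqaddoP => e e0; apply: filterS (H e e0) => h.
  by rewrite !fctE /= opprD addrA [x + h]addrC.
have dE := diff_unique cL Ed.
have df : differentiable f x by apply/diff_locallyP; rewrite dE.
by split=> // h; rewrite deriveE// dE.
Qed.

Lemma differentiable_bound V W (f : V -> W) x (e : R) : differentiable f x -> 0 < e ->
  \forall h \near (0 : V), `|f (x + h) - f x - 'D_h f x| <= e * `|h|.
Proof.
move=> df e0; have /eqaddoP/(_ e e0) := diff_locally df.
by apply: filterS => h /=; rewrite !fctE /= opprD addrA [x + h]addrC deriveE.
Qed.

Lemma near_eq_differentiable V W (f g : V -> W) x :
  {near x, f =1 g} -> differentiable f x -> differentiable g x.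
Proof.
move=> fg df; have [] // := @differentiable_of_bound _ _ g ('d f x) x (diff_continuous df).
move=> e e0; have fgx : f x = g x by exact: nbhs_singleton fg.
have E : \forall y \near 0, f (x + y) = g (x + y).
  have := fg; rewrite (near_shift 0 x) /=.
  by apply: filterS => y /=; rewrite subr0 addrC.
by apply: filterS2 (differentiable_bound df e0) E => y + E; rewrite E fgx deriveE.
Qed.

(** [diff_upto k] asks for differentiability of all iterated directional
   derivatives of order at most [k]. It peels off the innermost derivative,
   whereas [iter_derive] peels off the outermost one; this makes closure
   properties of smooth functions provable by induction on [k]. *)
Fixpoint diff_upto V W (k : nat) (U : set V) (f : V -> W) : Prop :=
  (forall x, U x -> differentiable f x) /\
  (if k is k'.+1 then forall v, diff_upto k' U ('D_v f) else True).

Lemma diff_upto_differentiable V W k U (f : V -> W) x : diff_upto k U f -> U x -> differentiable f x.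
Proof. by case: k => [|k] [h _]; exact: h. Qed.

Lemma diff_upto_derive V W k U (f : V -> W) v : diff_upto k.+1 U f -> diff_upto k U ('D_v f).
Proof. by move=> [_ h]; exact: h. Qed.

Lemma diff_uptoW V W k U (f : V -> W) : diff_upto k.+1 U f -> diff_upto k U f.
Proof.
elim: k f => [|k IH] f [d D]; first by split.
by split => // v; apply: IH; exact: D.
Qed.

Lemma smooth_onP V W (U : set V) (f : V -> W) :
  smooth_on U f <-> forall k, diff_upto k U f.
Proof.
split.
- move=> sf k; elim: k f sf => [|k IH] f sf; split => //; try exact: (sf [::]).
  move=> v; apply: IH => vs x Ux.
  have := sf (rcons vs v) x Ux; suff -> : iter_derive (rcons vs v) f = iter_derive vs ('D_v f) by [].
  by elim: vs => //= a vs ->.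
- move=> sf vs; elim/last_ind: vs f sf => [|vs v IH] f sf x Ux.
    by case: (sf 0%N) => + _; apply.
  suff -> : iter_derive (rcons vs v) f = iter_derive vs ('D_v f).
    by apply: IH => // k; exact: diff_upto_derive (sf k.+1).
  by elim: vs {IH} => //= a vs ->.
Qed.

Lemma diff_upto_eq V W k (U : set V) (f g : V -> W) : open U ->
  (forall x, U x -> f x = g x) -> diff_upto k U f -> diff_upto k U g.
Proof.
move=> oU; elim: k f g => [|k IH] f g fg cf.
  split=> // x Ux; apply: near_eq_differentiable (diff_upto_differentiable cf Ux).
  by apply: filterS (open_nbhs_nbhs (conj oU Ux)) => y /fg.
split=> [x Ux|v].
  apply: near_eq_differentiable (diff_upto_differentiable cf Ux).
  by apply: filterS (open_nbhs_nbhs (conj oU Ux)) => y /fg.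
apply: (IH ('D_v f)); last exact: diff_upto_derive cf.
move=> x Ux; apply: near_eq_derive.
by apply: filterS (open_nbhs_nbhs (conj oU Ux)) => y /fg.
Qed.

Lemma smooth_on_eq V W (U : set V) (f g : V -> W) : open U ->
  (forall x, U x -> f x = g x) -> smooth_on U f -> smooth_on U g.
Proof. by move=> oU fg /smooth_onP h; apply/smooth_onP => k; exact: diff_upto_eq (h k). Qed.

Lemma smooth_on_sub V W (U U' : set V) (f : V -> W) :
  U' `<=` U -> smooth_on U f -> smooth_on U' f.
Proof. by move=> s h vs x /s; exact: h. Qed.

(** Smoothness on a set is a pointwise condition: the iterated derivatives are
   taken in the whole space. *)
Lemma smooth_on_loc V W (U : set V) (f : V -> W) :
  (forall x, U x -> exists2 J : set V, J x & smooth_on J f) -> smooth_on U f.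
Proof. by move=> h vs x /h[J Jx]; exact. Qed.

Lemma smooth_on_differentiable V W (U : set V) (f : V -> W) x :
  smooth_on U f -> U x -> differentiable f x.
Proof. exact: (fun s => s [::] x). Qed.

Lemma smooth_on_derive V W (U : set V) (f : V -> W) v :
  smooth_on U f -> smooth_on U ('D_v f).
Proof. by move=> /smooth_onP h; apply/smooth_onP => k; exact: diff_upto_derive (h k.+1). Qed.

Lemma derive_lin V W (f : V -> W) x (k : R) u v : differentiable f x ->
  'D_(k *: u + v) f x = k *: 'D_u f x + 'D_v f x.
Proof. by move=> d; rewrite !deriveE// linearP. Qed.

Lemma derive_sumdir V W (f : V -> W) x m (a : 'I_m -> R) (u : 'I_m -> V) :
  differentiable f x ->
  'D_(\sum_i a i *: u i) f x = \sum_i a i *: 'D_(u i) f x.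
Proof.
move=> d; rewrite deriveE// linear_sum; apply: eq_bigr => i _.
by rewrite linearZ deriveE.
Qed.

Lemma diff_upto_cst V W k (U : set V) (w : W) : diff_upto k U (fun=> w).
Proof.
elim: k w => [|k IH] w; split => // v.
rewrite (_ : 'D_v _ = fun=> 0); first exact: IH.
by apply/funext => x; exact: derive_cst.
Qed.

Lemma diff_uptoD V W k (U : set V) (f g : V -> W) : open U ->
  diff_upto k U f -> diff_upto k U g -> diff_upto k U (fun x => f x + g x).
Proof.
move=> oU; elim: k f g => [|k IH] f g [df Df] [dg Dg]; split => //.
- by move=> x Ux; apply: differentiableD; [exact: df|exact: dg].
- by move=> x Ux; apply: differentiableD; [exact: df|exact: dg].
- move=> v; apply: (diff_upto_eq oU) (IH _ _ (Df v) (Dg v)) => x Ux.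
  by rewrite (deriveD (f:=f) (g:=g))//; apply: diff_derivable; [exact: df|exact: dg].
Qed.

Lemma diff_upto_sum V W k (U : set V) m (f : 'I_m -> V -> W) : open U ->
  (forall i, diff_upto k U (f i)) -> diff_upto k U (fun x => \sum_i f i x).
Proof.
move=> oU; elim: m f => [|m IH] f h.
  apply: (diff_upto_eq oU) (diff_upto_cst k U 0) => x _; by rewrite big_ord0.
apply: (diff_upto_eq oU) (diff_uptoD oU (h ord0) (IH _ (fun i => h (lift ord0 i)))) => x _.
by rewrite big_ord_recl.
Qed.

Lemma diff_uptoM V k (U : set V) (f g : V -> R^o) : open U ->
  diff_upto k U f -> diff_upto k U g -> diff_upto k U (fun x => f x * g x : R^o).
Proof.
move=> oU; elim: k f g => [|k IH] f g cf cg; split => //.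
- by move=> x Ux; apply: (@differentiableM _ _ f g); [exact: diff_upto_differentiable cf _|exact: diff_upto_differentiable cg _].
- by move=> x Ux; apply: (@differentiableM _ _ f g); [exact: diff_upto_differentiable cf _|exact: diff_upto_differentiable cg _].
- move=> v; apply: (diff_upto_eq oU) (diff_uptoD oU (IH _ _ (diff_uptoW cf) (diff_upto_derive v cg)) (IH _ _ (diff_uptoW cg) (diff_upto_derive v cf))) => x Ux.
  by rewrite (@deriveM _ _ f g)//; apply: diff_derivable; [exact: diff_upto_differentiable cf _|exact: diff_upto_differentiable cg _].
Qed.

(** Chain rule with the inner derivative as the direction of the outer one, so
   that it applies again to iterated derivatives. *)
Lemma derive_comp (U V W : normedModType R) (g : U -> V) (f : V -> W) x v :
  differentiable g x -> differentiable f (g x) ->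
  'D_v (f \o g) x = 'D_('D_v g x) f (g x).
Proof.
move=> dg df; rewrite !deriveE//; last exact: differentiable_comp.
by rewrite diff_comp.
Qed.

Lemma differentiable_row V m (f : V -> 'rV[R]_m) x :
  (forall i, differentiable (fun y => f y 0 i : R^o) x) -> differentiable f x.
Proof.
move=> h; have -> : f = \sum_(i < m) (fun y => f y 0 i *: (delta_mx 0 i : 'rV[R]_m)).
  apply/funext => y; rewrite [LHS]row_sum_delta.
  by elim/big_ind2 : _ => // ? ? ? ? -> ->.
by apply: differentiable_sum => i; apply: differentiableZl; exact: h.
Qed.

Lemma differentiable_row_coord V m (f : V -> 'rV[R]_m) x i :
  differentiable f x -> differentiable (fun y => f y 0 i : R^o) x.
Proof.
move=> h; apply: (@differentiable_comp _ _ _ _ f (fun M : 'rV[R]_m => M 0 i : R^o)) => //.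
exact: differentiable_coord.
Qed.

Lemma derive_coord V m (f : V -> 'rV[R]_m) x v i :
  differentiable f x -> ('D_v f x) 0 i = 'D_v (fun y => f y 0 i : R^o) x.
Proof. by move=> h; rewrite derive_mx ?mxE//; exact: diff_derivable. Qed.

Lemma diff_upto_rowP V m k (U : set V) (f : V -> 'rV[R]_m) : open U ->
  diff_upto k U f <-> forall i, diff_upto k U (fun y => f y 0 i : R^o).
Proof.
move=> oU; elim: k f => [|k IH] f; split.
- by move=> [h _] i; split => // x Ux; apply: differentiable_row_coord; exact: h.
- by move=> h; split => // x Ux; apply: differentiable_row => i; exact: diff_upto_differentiable (h i) _.
- move=> h i; split; first by move=> x Ux; apply: differentiable_row_coord; exact: diff_upto_differentiable h _.
  move=> v; apply: (diff_upto_eq oU) ((IH _).1 (diff_upto_derive v h) i) => x Ux.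
  by rewrite derive_coord//; exact: diff_upto_differentiable h _.
- move=> h; have d x : U x -> differentiable f x.
    by move=> Ux; apply: differentiable_row => i; exact: diff_upto_differentiable (h i) _.
  split => // v; apply/IH => i; apply: (diff_upto_eq oU) (diff_upto_derive v (h i)) => x Ux.
  by rewrite derive_coord//; exact: d.
Qed.

(** By the chain rule, a derivative of [f \o g] is the sum over the coordinates
   of a derivative of [g] times [h \o g], where [h] is a partial derivative of
   [f]: one order less on both sides, which feeds the induction. *)
Lemma diff_upto_comp V m k (U : set V) (U' : set 'rV[R]_m) (g : V -> 'rV[R]_m)
    (f : 'rV[R]_m -> R^o) : open U ->
  diff_upto k U g -> diff_upto k U' f -> (forall x, U x -> U' (g x)) -> diff_upto k U (f \o g).
Proof.
move=> oU; elim: k f g => [|k IH] f g cg cf gU.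
  split=> // x Ux; apply: differentiable_comp; first exact: diff_upto_differentiable cg _.
  by apply: diff_upto_differentiable cf _; exact: gU.
split=> [x Ux|v].
  apply: differentiable_comp; first exact: diff_upto_differentiable cg _.
  by apply: diff_upto_differentiable cf _; exact: gU.
have h i : diff_upto k U (fun x => ('D_v g x) 0 i * ('D_(delta_mx 0 i) f \o g) x : R^o).
  apply: diff_uptoM => //; first exact: (diff_upto_rowP k _ oU).1 (diff_upto_derive _ cg) i.
  by apply: IH => //; [exact: diff_uptoW|exact: diff_upto_derive].
apply: (diff_upto_eq oU) (diff_upto_sum oU h) => x Ux.
have df : differentiable f (g x) by apply: diff_upto_differentiable cf _; exact: gU.
have -> : \sum_i ('D_v g x) 0 i * ('D_(delta_mx 0 i) f \o g) x = 'D_(\sum_i ('D_v g x) 0 i *: delta_mx 0 i) f (g x) by rewrite derive_sumdir.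
rewrite -row_sum_delta [RHS](@derive_comp _ _ _ g f)//; exact: (diff_upto_differentiable cg Ux).
Qed.

Lemma diff_upto_comp1 V k (U : set V) (U' : set R^o) (g : V -> R^o)
    (f : R^o -> R^o) : open U ->
  diff_upto k U g -> diff_upto k U' f -> (forall x, U x -> U' (g x)) -> diff_upto k U (f \o g).
Proof.
move=> oU; elim: k f g => [|k IH] f g cg cf gU.
  split=> // x Ux; apply: differentiable_comp; first exact: diff_upto_differentiable cg _.
  by apply: diff_upto_differentiable cf _; exact: gU.
split=> [x Ux|v].
  apply: differentiable_comp; first exact: diff_upto_differentiable cg _.
  by apply: diff_upto_differentiable cf _; exact: gU.
have h : diff_upto k U (fun x => 'D_v g x * ('D_1 f \o g) x : R^o).
  apply: diff_uptoM => //; first exact: diff_upto_derive cg.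
  by apply: IH => //; [exact: diff_uptoW|exact: diff_upto_derive].
apply: (diff_upto_eq oU) h => x Ux.
have df : differentiable f (g x) by apply: diff_upto_differentiable cf _; exact: gU.
rewrite [RHS](@derive_comp _ _ _ g f)//; last exact: diff_upto_differentiable cg Ux.
transitivity ('D_('D_v g x *: (1 : R^o)) f (g x)); last by rewrite [_%:A]mulr1.
rewrite [RHS]deriveE// linearZ. rewrite -deriveE//.
Qed.

End DiffUpto.

Section Smooth.
Context {R : realType} {V : normedModType R}.
Implicit Types U : set V.

Lemma smooth_cst (W : normedModType R) U (w : W) : smooth_on U (fun=> w).
Proof. by apply/smooth_onP => k; exact: diff_upto_cst. Qed.

Lemma smoothD (W : normedModType R) U (f g : V -> W) : open U ->
  smooth_on U f -> smooth_on U g -> smooth_on U (fun x => f x + g x).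
Proof. by move=> oU /smooth_onP f1 /smooth_onP g1; apply/smooth_onP => k; exact: diff_uptoD. Qed.

Lemma smooth_sum (W : normedModType R) U m (f : 'I_m -> V -> W) : open U ->
  (forall i, smooth_on U (f i)) -> smooth_on U (fun x => \sum_i f i x).
Proof. by move=> oU h; apply/smooth_onP => k; apply: diff_upto_sum => // i; move: k; apply/smooth_onP. Qed.

Lemma smoothM U (f g : V -> R^o) : open U ->
  smooth_on U f -> smooth_on U g -> smooth_on U (fun x => f x * g x : R^o).
Proof. by move=> oU /smooth_onP f1 /smooth_onP g1; apply/smooth_onP => k; exact: diff_uptoM. Qed.

Lemma smooth_prod U m (f : 'I_m -> V -> R^o) : open U ->
  (forall i, smooth_on U (f i)) -> smooth_on U (fun x => \prod_i f i x : R^o).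
Proof.
move=> oU; elim: m f => [|m IH] f h.
  by apply: (@smooth_on_eq R V R^o U (fun=> 1)) => [|x _|] //; [rewrite big_ord0|exact: smooth_cst].
apply: (smooth_on_eq oU) (smoothM oU (h ord0) (IH _ (fun i => h (lift ord0 i)))) => x _.
by rewrite big_ord_recl.
Qed.

Lemma smooth_rowP m U (f : V -> 'rV[R]_m) : open U ->
  smooth_on U f <-> forall i, smooth_on U (fun y => f y 0 i : R^o).
Proof.
move=> oU; split.
  by move=> /smooth_onP h i; apply/smooth_onP => k; move: i; apply/diff_upto_rowP.
by move=> h; apply/smooth_onP => k; apply/diff_upto_rowP => // i; move: k; apply/smooth_onP.
Qed.

Lemma smooth_comp m U (U' : set 'rV[R]_m) (g : V -> 'rV[R]_m)
    (f : 'rV[R]_m -> R^o) : open U ->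
  smooth_on U g -> smooth_on U' f -> (forall x, U x -> U' (g x)) ->
  smooth_on U (f \o g).
Proof.
by move=> oU /smooth_onP f1 /smooth_onP g1 s; apply/smooth_onP => k; exact: diff_upto_comp s.
Qed.

Lemma smooth_comp1 U (U' : set R^o) (g : V -> R^o) (f : R^o -> R^o) : open U ->
  smooth_on U g -> smooth_on U' f -> (forall x, U x -> U' (g x)) ->
  smooth_on U (f \o g).
Proof.
by move=> oU /smooth_onP f1 /smooth_onP g1 s; apply/smooth_onP => k; exact: diff_upto_comp1 s.
Qed.

Lemma smooth_continuous_linear (W : normedModType R) U (f : {linear V -> W}) :
  continuous f -> smooth_on U f.
Proof.
move=> cf; apply/smooth_onP => -[|k].
  by split => // x _; exact: linear_differentiable.
split => [x _|v]; first exact: linear_differentiable.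
rewrite (_ : 'D_v f = fun=> f v); first exact: diff_upto_cst.
by apply/funext => x; rewrite deriveE ?diff_lin//; exact: linear_differentiable.
Qed.

Lemma smooth_id U : smooth_on U (id : V -> V).
Proof. by apply: (@smooth_continuous_linear V U idfun) => x; exact: cvg_id. Qed.

(** A directional derivative only sees the values on one line: vertical
   derivatives are compared below by comparing functions of one real
   variable. *)
Lemma derive_line (W : normedModType R) (f : V -> W) x v :
  'D_v f x = 'D_(1 : R^o) (fun t : R^o => f (x + t *: v)) 0.
Proof.
rewrite /derive; set a := fun h => _; set b := fun h => _.
suff -> : a = b by [].
apply/funext => h; rewrite /a /b /= scale0r !addr0 [h *: 1]mulr1. by rewrite [h *: v + x]addrC.
Qed.

End Smooth.

Section SmoothRow.
Context {R : realType}.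

Lemma smooth_compv (V : normedModType R) m p U (U' : set 'rV[R]_m) (g : V -> 'rV[R]_m)
    (f : 'rV[R]_m -> 'rV[R]_p) : open U -> open U' ->
  smooth_on U g -> smooth_on U' f -> (forall x, U x -> U' (g x)) ->
  smooth_on U (f \o g).
Proof.
move=> oU oU' sg sf s; apply/smooth_rowP => // i.
exact: (smooth_comp oU sg ((smooth_rowP f oU').1 sf i) s).
Qed.

Lemma smooth_coord m (U : set 'rV[R]_m) i :
  smooth_on U (fun x : 'rV[R]_m => x 0 i : R^o).
Proof.
have lin : linear (fun x : 'rV[R]_m => x 0 i : R^o) by move=> k x y; rewrite !mxE.
pose f : {linear 'rV[R]_m -> R^o} := HB.pack (fun x : 'rV[R]_m => x 0 i : R^o)
  (GRing.isLinear.Build _ _ _ _ _ lin).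
apply: (smooth_continuous_linear (f := f)) => x; exact: coord_continuous.
Qed.

End SmoothRow.

(** * Bump functions *)

Section Bump.
Context {R : realType}.

Lemma exprn_le_expR (n : nat) (y : R) : 0 <= y -> y ^+ n <= n`!%:R * expR y.
Proof.
move=> y0; case: n => [|n]; first by rewrite expr0 fact0 mul1r -expR0 ler_expR.
have n0 : 0 < (n.+1)`!%:R :> R by rewrite ltr0n fact_gt0.
rewrite mulrC -ler_pdivrMr//; apply: le_trans (expR_ge1Dxn n y0).
by rewrite lerDr.
Qed.

Lemma expR_dominates_poly (p : {poly R}) (n : nat) :
  exists C : R, 0 <= C /\ forall y, 0 <= y -> `|p.[y]| * y ^+ n <= C * expR y.
Proof.
elim/poly_ind: p n => [|p c IH] n.
  by exists 0; split=> // y _; rewrite horner0 normr0 !mul0r.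
have [C1 [C10 h1]] := IH n.+1; exists (C1 + `|c| * n`!%:R); split; first by rewrite addr_ge0 ?mulr_ge0.
move=> y y0; rewrite hornerMXaddC.
apply: (@le_trans _ _ ((`|p.[y]| * y + `|c|) * y ^+ n)).
  rewrite ler_wpM2r ?exprn_ge0//; apply: le_trans (ler_normD _ _) _.
  by rewrite normrM (ger0_norm y0).
rewrite !mulrDl lerD//; first by rewrite -mulrA -exprS h1.
by rewrite -mulrA ler_wpM2l// exprn_le_expR.
Qed.

(** The functions p(1/x) exp(-1/x), extended by 0 to x <= 0. This class is
   stable under differentiation (see [is_derive_flat]), hence consists of smooth
   functions. *)
Definition flat (p : {poly R}) (x : R^o) : R^o :=
  if 0 < x then p.[x^-1] * expR (- x^-1) else 0.

(** As exp(y) dominates p(y) y^2 for y = 1/x > 0, the function is quadratically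
   small at 0, which gives the derivative there. *)
Lemma flat_le_sqr p : exists C : R, 0 <= C /\ forall x, `|flat p x| <= C * x ^+ 2.
Proof.
have [C [C0 h]] := expR_dominates_poly p 2; exists C; split=> // x.
rewrite /flat; case: ifPn => [x0|_]; last by rewrite normr0 mulr_ge0// sqr_ge0.
have := h x^-1; rewrite invr_ge0 ltW// => /(_ isT) {}h.
rewrite normrM (ger0_norm (expR_ge0 _)) expRN ler_pdivrMr ?expR_gt0//.
rewrite mulrAC -ler_pdivrMr ?exprn_gt0//.
by rewrite -exprVn.
Qed.

Lemma is_derive_sqr_bound (f : R^o -> R^o) (C : R) : 0 <= C ->
  (forall x, `|f x| <= C * x ^+ 2) -> is_derive 0 (1 : R^o) f 0.
Proof.
move=> C0 h; have f0 : f 0 = 0.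
  by apply/eqP; rewrite -normr_le0; apply: le_trans (h 0) _; rewrite expr2 !mulr0.
have H : (fun t : R => t^-1 *: ((f \o shift 0) (t *: (1 : R^o)) - f 0)) @ 0^' --> (0 : R^o).
  apply/cvgrPdist_le => e e0; near=> t.
  have t0 : t != 0 by near: t; exact: nbhs_dnbhs_neq.
  rewrite /= f0 subr0 addr0 [t *: 1]mulr1 sub0r normrN normrM normfV.
  rewrite mulrC ler_pdivrMr ?normr_gt0//; apply: le_trans (h t) _.
  rewrite -real_normK ?num_real// expr2 mulrA ler_wpM2r//.
  have tl : `|t| <= e / (C + 1) by near: t; apply: dnbhs0_le; rewrite divr_gt0// ltr_wpDl.
  apply: (@le_trans _ _ (C * (e / (C + 1)))); first by rewrite ler_wpM2l.
  rewrite mulrA ler_pdivrMr ?ltr_wpDl// mulrC ler_wpM2l ?(ltW e0)//.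
  by rewrite lerDl.
apply: DeriveDef; first by apply/cvg_ex; exists 0.
exact: cvg_lim H.
Unshelve. all: by end_near.
Qed.

(** With y = 1/x one has (p(y) exp(-y))' = y^2 (p(y) - p'(y)) exp(-y); at 0 both
   sides vanish by flatness. *)
Lemma is_derive_flat p (x : R^o) :
  is_derive x (1 : R^o) (flat p) (flat ('X^2 * (p - p^`())) x).
Proof.
have [x0|x0|->] := ltgtP x 0.
- have E : \forall y \near x, cst (0 : R^o) y = flat p y.
    near=> y; rewrite /flat /= ltNge ltW//; near: y; exact: lt_nbhsl.
  apply: near_eq_is_derive E _.
  by rewrite /flat ltNge ltW//=; exact: is_derive_cst.
- have E : \forall y \near x, p.[y^-1] * expR (- y^-1) = flat p y.
    near=> y; rewrite /flat ifT//; near: y; exact: lt_nbhsr.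
  apply: (near_eq_is_derive (f := fun y : R^o => p.[y^-1] * expR (- y^-1) : R^o) E).
  have xn0 : x != 0 by rewrite gt_eqF.
  have iV : is_derive x (1 : R^o) (fun y : R^o => y^-1 : R^o) (- x ^- 2).
    apply: DeriveDef; first exact: derivableV.
    by rewrite deriveV// derive_id [_%:A]mulr1.
  have iN : is_derive x (1 : R^o) (fun y : R^o => - y^-1 : R^o) (x ^- 2).
    by rewrite -[x ^- 2]opprK; exact: is_deriveN.
  have i1 := @is_derive1_comp R (horner p) (fun y => y^-1) x _ _ (is_derive_poly p x^-1) iV.
  have i2 := @is_derive1_comp R (@expR R) (fun y => - y^-1) x _ _ (is_derive_expR _) iN.
  apply: (is_derive_eq (is_deriveM i1 i2)); rewrite /flat x0 /= !hornerE /= exprVn.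
  by rewrite /GRing.scale /=; ring.
have [C [C0 h]] := flat_le_sqr p.
by rewrite {2}/flat ltxx; exact: is_derive_sqr_bound h.
Unshelve. all: by end_near.
Qed.

Lemma smooth_flat p : smooth_on setT (flat p).
Proof.
apply/smooth_onP => k; elim: k p => [|k IH] p.
  by split=> // x _; apply/derivable1_diffP; have [] := is_derive_flat p x.
have d x : differentiable (flat p) x.
  by apply/derivable1_diffP; have [] := is_derive_flat p x.
split=> // v.
have E x : v * flat ('X^2 * (p - p^`())) x = 'D_v (flat p) x.
  have [_ <-] := is_derive_flat p x.
  by rewrite !deriveE// -[X in _ = 'd _ _ X]mulr1 [RHS]linearZ.
apply: (diff_upto_eq openT (fun x _ => E x)); apply: diff_uptoM; [exact: openT|exact: diff_upto_cst|exact: IH].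
Qed.

Lemma smooth_inv : smooth_on [set x : R^o | x != 0] (fun x : R^o => x^-1 : R^o).
Proof.
have oU : open [set x : R^o | x != 0].
  exact: open_neq.
apply/smooth_onP; elim => [|k IH].
  by split=> // x x0; exact: differentiable_Rinv.
split=> [x x0|v]; first exact: differentiable_Rinv.
have h := diff_uptoM oU (diff_upto_cst k [set x : R^o | x != 0] (- v : R^o)) (diff_uptoM oU IH IH).
apply: (diff_upto_eq oU) h => x x0.
rewrite [RHS](deriveV (f := fun y : R^o => y) x0 (@derivable_id _ _ _ _)).
by rewrite derive_id -invfM -expr2 mulNr mulrC -mulNr.
Qed.

(** A smooth transition from 0 (for x <= 0) to 1 (for x >= 1); the denominator
   never vanishes since x and 1 - x are not both nonpositive. *)
Definition step (x : R^o) : R^o := flat 1 x / (flat 1 x + flat 1 (1 - x)).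

Lemma flat1_ge0 x : 0 <= flat 1 x.
Proof. by rewrite /flat; case: ifP => // _; rewrite hornerC mul1r expR_ge0. Qed.

Lemma flat1_gt0 x : 0 < x -> 0 < flat 1 x.
Proof. by rewrite /flat => ->; rewrite hornerC mul1r expR_gt0. Qed.

Lemma flat_le0 p x : x <= 0 -> flat p x = 0.
Proof. by rewrite /flat leNgt => /negPf ->. Qed.

Lemma smooth_step : smooth_on setT step.
Proof.
have s1 : smooth_on setT (fun x : R^o => flat 1 (1 - x)).
  apply: (@smooth_comp1 R R^o setT setT (fun x => 1 - x) (flat 1) openT) => //.
    apply: (smoothD openT); first exact: smooth_cst.
    apply: (@smooth_on_eq R R^o R^o setT (fun x => (-1) * x) _ openT) => [x _|].
      by rewrite mulN1r.
    by apply: (smoothM openT); [exact: smooth_cst|exact: smooth_id].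
  exact: smooth_flat.
apply: (smoothM openT); first exact: smooth_flat.
have s2 := smoothD openT (@smooth_flat 1) s1.
apply: (smooth_comp1 openT s2 smooth_inv) => x _ /=.
rewrite gt_eqF//; have [x0|x0] := ltP 0 x.
  by rewrite ltr_pwDl// ?flat1_gt0 ?flat1_ge0.
by rewrite ltr_wpDl ?flat1_ge0// flat1_gt0// subr_gt0 (le_lt_trans x0).
Qed.

Lemma step0 x : x <= 0 -> step x = 0.
Proof. by move=> x0; rewrite /step flat_le0// mul0r. Qed.

Lemma step1 x : 1 <= x -> step x = 1.
Proof.
move=> x1; rewrite /step (@flat_le0 1 (1 - x)) ?subr_le0// addr0 divff//.
by rewrite gt_eqF// flat1_gt0// (lt_le_trans _ x1).
Qed.

Context {N : nat}.

Lemma bump_rV (z0 : 'rV[R]_N) (e : R) : 0 < e ->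
  exists b : 'rV[R]_N -> R^o, [/\ smooth_on setT b,
    forall z, `|z - z0| <= e -> b z = 1 & forall z, 2 * e <= `|z - z0| -> b z = 0].
Proof.
move=> e0.
(* The bump is the product over the coordinates t of step(2 + t) step(2 - t),
   with t rescaled by e: such a factor is 1 for |t| <= 1 and 0 for |t| >= 2. *)
pose l i (c : R) (z : 'rV[R]_N) : R^o := 2 + c * (z 0 i - z0 0 i).
have sl i c : smooth_on setT (l i c).
  apply: (smoothD openT); first exact: smooth_cst.
  apply: (smoothM openT); first exact: smooth_cst.
  by apply: (smoothD openT); [exact: smooth_coord|exact: smooth_cst].
exists (fun z => \prod_i (step (l i e^-1 z) * step (l i (- e^-1) z)) : R^o); split.
- apply: (smooth_prod openT) => i; apply: (smoothM openT);
    by apply: (smooth_comp1 openT (sl _ _) smooth_step).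
- move=> z ze; rewrite big1// => i _.
  have : `|z 0 i - z0 0 i| / e <= 1.
    rewrite ler_pdivrMr// mul1r (le_trans _ ze)//.
    rewrite [leRHS]/Num.Def.normr/= mx_normrE.
    have := le_bigmax (0%R : R) (fun ij => `|(z - z0) ij.1 ij.2|) (0, i).
    by rewrite /= !mxE.
  rewrite -[X in _ / X](gtr0_norm e0) -normf_div ler_norml => /andP[h1 h2].
  rewrite !step1 ?mulr1// /l.
    by move: h2; rewrite mulrC mulNr; lra.
  by move: h1; rewrite mulrC; lra.
- move=> z ze.
  have [i hi] : exists i, 2 * e <= `|z 0 i - z0 0 i|.
    apply/not_existsP => H.
    move: ze; apply/negP; rewrite -ltNge [ltLHS]/Num.Def.normr/= mx_normrE.
    apply/bigmax_ltP; split; first by rewrite mulr_gt0.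
    move=> [a i] _ /=; rewrite ord1 !mxE ltNge; exact/negP/H.
  rewrite (bigD1 i)//=.
  have : 2 <= `|(z 0 i - z0 0 i) / e|.
    by rewrite normf_div (gtr0_norm e0) ler_pdivlMr.
  rewrite ler_normr => /orP[h|h].
    rewrite [step (l i (- e^-1) z)]step0 ?mulr0 ?mul0r// /l.
    by move: h; rewrite mulNr mulrC; lra.
  rewrite [step (l i e^-1 z)]step0 ?mul0r// /l.
  by move: h; rewrite mulrC; lra.
Qed.

(** The compact support is what allows extension by zero from a chart to a
   Hausdorff manifold. *)
Lemma bump_in (O : set 'rV[R]_N) (z0 : 'rV[R]_N) : open O -> O z0 ->
  exists (b : 'rV[R]_N -> R^o) (K J : set 'rV[R]_N),
    [/\ smooth_on setT b, compact K /\ closed K, K `<=` O,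
        [/\ open J, J z0, J `<=` K & forall z, J z -> b z = 1] &
        forall z, b z <> 0 -> K z].
Proof.
move=> oO Oz0; have /nbhs_normP[d /= d0 hd] := open_nbhs_nbhs (conj oO Oz0).
pose e := d / 3.
have e0 : 0 < e by rewrite divr_gt0.
have e2 : e <= 2 * e by rewrite ler_peMl ?(ltW e0)// ler1n.
have [b [sb b1 b0]] := bump_rV z0 e0.
pose K := closed_ball_ Num.norm z0 (2 * e).
have cK : closed K by exact: closed_closed_ball_.
exists b, K, (ball z0 e); split=> //.
- split=> //; apply: bounded_closed_compact => //.
  exists (`|z0| + 2 * e); split; first exact: num_real.
  move=> x xM z; rewrite /K /closed_ball_ /= distrC => ze; apply/ltW; apply: le_lt_trans xM.
  by rewrite -(subrK z0 z) addrC; apply: le_trans (ler_normD _ _) _; rewrite lerD2l.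
- by move=> z Kz; apply: hd => /=; rewrite (le_lt_trans Kz)// /e; move: d0; lra.
- split; [exact: ball_open|exact: ballxx| |].
    by move=> z; rewrite -ball_normE /= => ze; exact: le_trans (ltW ze) e2.
  by move=> z; rewrite -ball_normE /= distrC => ze; rewrite b1// ltW.
- move=> z bz; rewrite /K /closed_ball_ /= distrC leNgt.
  by apply/negP => /ltW /b0.
Qed.

Lemma smooth_extension (O : set 'rV[R]_N) z0 (f : 'rV[R]_N -> R^o) :
  open O -> O z0 -> smooth_on O f ->
  exists g : 'rV[R]_N -> R^o, smooth_on setT g /\
    exists J, [/\ open J, J z0, J `<=` O & forall z, J z -> g z = f z].
Proof.
move=> oO Oz0 sf; have [b [K [J [sb [_ cK] KO [oJ Jz JK b1] b0]]]] := bump_in oO Oz0.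
exists (fun z => b z * f z); split; last first.
  by exists J; split=> // [z /JK/KO|z Jz']; rewrite // b1// mul1r.
apply: smooth_on_loc => z _; have [Oz|nOz] := pselect (O z).
  by exists O => //; apply: (smoothM oO) => //; exact: smooth_on_sub sb.
have oC : open (~` K) by exact: closed_openC.
exists (~` K); first by move=> /KO.
apply: (smooth_on_eq oC) (@smooth_cst R _ R^o _ 0) => y Ky.
by have [->|/eqP/b0] := eqVneq (b y) 0; rewrite ?mul0r.
Qed.

End Bump.

(** * Mean values along lines and the symmetry of second derivatives *)

Section Schwarz.
Context {R : realType} {V : normedModType R}.

Lemma is_derive_line (x v : V) (t : R^o) :
  is_derive t (1 : R^o) (fun t : R^o => x + t *: v) v.
Proof.
have h2 := is_diff_scalel t v.
have d1 : derivable (cst x) t (1 : R^o) by exact: derivable_cst.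
have d2 : derivable ( *:%R^~ v : R^o -> V) t (1 : R^o).
  by apply: diff_derivable; case: h2.
have -> : (fun t : R^o => x + t *: v) = cst x + ( *:%R^~ v : R^o -> V) by [].
apply: DeriveDef; first exact: derivableD.
rewrite deriveD// derive_cst add0r.
by rewrite deriveE ?diff_val ?scale1r//; case: h2.
Qed.

Lemma differentiable_line (x v : V) (t : R^o) : differentiable (fun t : R^o => x + t *: v) t.
Proof. by apply/derivable1_diffP; have [] := is_derive_line x v t. Qed.

Lemma derive_along_line (W : normedModType R) (f : V -> W) (x v : V) (t : R^o) :
  differentiable f (x + t *: v) ->
  is_derive t (1 : R^o) (fun t : R^o => f (x + t *: v)) ('D_v f (x + t *: v)).
Proof.
move=> df; have dl := differentiable_line x v t.
apply: DeriveDef.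
  apply: diff_derivable; exact: (@differentiable_comp _ _ _ _ (fun t : R^o => x + t *: v) f).
rewrite (@derive_comp _ _ _ _ (fun t : R^o => x + t *: v) f)//.
by rewrite (@derive_val _ _ _ _ _ _ _ (is_derive_line x v t)).
Qed.

Lemma mvt_line (f : V -> R^o) (x v : V) (s : R) : 0 < s ->
  (forall t, 0 <= t <= s -> differentiable f (x + t *: v)) ->
  exists2 c : R, 0 <= c <= s & f (x + s *: v) - f x = 'D_v f (x + c *: v) * s.
Proof.
move=> s0 df.
have [||c cs E] := @MVT_segment R (fun t : R^o => f (x + t *: v)) (fun t => 'D_v f (x + t *: v))
  0 s (ltW s0).
- move=> t; rewrite in_itv /= => /andP[t0 ts].
  by apply: derive_along_line; apply: df; rewrite !ltW.
- apply: continuous_in_subspaceT => t; rewrite inE /= in_itv /= => ts.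
  apply: (@differentiable_continuous _ _ _ t (fun t : R^o => f (x + t *: v))).
  apply: (@differentiable_comp _ _ _ _ (fun t : R^o => x + t *: v) f); first exact: differentiable_line.
  exact: df.
exists c; first by move: cs; rewrite in_itv.
by move: E; rewrite scale0r addr0 subr0.
Qed.

Lemma derive_translate (W : normedModType R) (f : V -> W) (w z a : V) :
  'D_a (fun y => f (y + w)) z = 'D_a f (z + w).
Proof.
rewrite /derive; set A := fun h => _; set B := fun h => _; suff -> : A = B by [].
by apply/funext => h; rewrite /A /B /= addrA.
Qed.

(** Apply the mean value theorem to y |-> f(y + s b) - f(y) in the direction
   [a], then the differentiability of ['D_a f] at [x]. The left-hand side is
   symmetric in [a] and [b] up to the last term. *)
Lemma second_difference (U : set V) (f : V -> R^o) x a b (e : R) : open U ->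
  smooth_on U f -> U x -> 0 < e ->
  \forall s \near (0 : R)^'+,
    `|f (x + s *: a + s *: b) - f (x + s *: a) - f (x + s *: b) + f x
      - s ^+ 2 * 'D_b ('D_a f) x| <= e * s ^+ 2.
Proof.
move=> oU sf Ux e0.
have dg : differentiable ('D_a f) x by exact: smooth_on_differentiable (smooth_on_derive a sf) Ux.
(* s M bounds both the points c a + t b of the parallelogram and the sum of the
   two error terms; the summand 1 keeps it positive. *)
pose M := 2 * `|a| + `|b| + 1.
have M0 : 0 < M by rewrite /M ltr_wpDl// addr_ge0// mulr_ge0.
have eM : 0 < e / M by rewrite divr_gt0.
have Ub := open_nbhs_nbhs (conj oU Ux).
have /nbhs_normP[d1 /= d10 h1] := Ub.
have /nbhs_normP[d2 /= d20 h2] := differentiable_bound dg eM.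
have small (c s : R) : 0 <= c <= s -> 0 < s -> s < Num.min d1 d2 / M ->
    forall t : R, 0 <= t <= s -> `|c *: a + t *: b| < Num.min d1 d2.
  move=> /andP[c0 cs] s0 sd t /andP[t0 ts].
  apply: (le_lt_trans (ler_normD _ _)); rewrite !normrZ !ger0_norm//.
  apply: (@le_lt_trans _ _ (s * M)); last by rewrite -ltr_pdivlMr.
  have : c * `|a| <= s * `|a| by rewrite ler_wpM2r.
  have : t * `|b| <= s * `|b| by rewrite ler_wpM2r.
  have : 0 <= s * `|a| by rewrite mulr_ge0// ltW.
  rewrite /M; lra.
near=> s.
have s0 : 0 < s by near: s; exact: nbhs_right_gt.
have sd : s < Num.min d1 d2 / M.
  by near: s; apply: nbhs_right_lt; rewrite divr_gt0// lt_min d10.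
have inU c t : 0 <= c <= s -> 0 <= t <= s -> U (x + (c *: a + t *: b)).
  move=> cs ts; apply: h1; rewrite /= opprD addrA subrr add0r normrN.
  by apply: lt_le_trans (small _ _ cs s0 sd _ ts) _; rewrite ge_min lexx.
have inD c t : 0 <= c <= s -> 0 <= t <= s ->
    `|'D_a f (x + (c *: a + t *: b)) - 'D_a f x - 'D_(c *: a + t *: b) ('D_a f) x|
      <= e / M * (c * `|a| + t * `|b|).
  move=> cs ts; apply: (@le_trans _ _ (e / M * `|c *: a + t *: b|)).
    apply: h2; rewrite /= sub0r normrN.
    by apply: lt_le_trans (small _ _ cs s0 sd _ ts) _; rewrite ge_min lexx orbT.
  rewrite ler_wpM2l ?(ltW eM)//; apply: (le_trans (ler_normD _ _)).
  by case/andP: cs => ? _; case/andP: ts => ? _; rewrite !normrZ !ger0_norm.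
have s00 : (0 : R) <= 0 <= s by rewrite lexx ltW.
have sss : 0 <= s <= s by rewrite lexx ltW.
have df c t : 0 <= c <= s -> 0 <= t <= s -> differentiable f (x + (c *: a + t *: b)).
  by move=> cs ts; apply: smooth_on_differentiable sf _; exact: inU.
pose phi (y : V) : R^o := f (y + s *: b) - f y.
have dsh (y : V) : differentiable f (y + s *: b) -> differentiable (fun y => f (y + s *: b)) y.
  move=> dd; apply: (@differentiable_comp _ _ _ _ (fun y => y + s *: b) f) => //.
have dphi c : 0 <= c <= s -> differentiable phi (x + c *: a).
  move=> cs; apply: differentiableB.
    by apply: dsh; rewrite -addrA; apply: df.
  by have := df c 0 cs s00; rewrite scale0r addr0.
have [c cs E] := mvt_line s0 dphi.
have Dphi : 'D_a phi (x + c *: a) = 'D_a f (x + (c *: a + s *: b)) - 'D_a f (x + c *: a).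
  have df1 : differentiable f (x + c *: a + s *: b) by rewrite -addrA; exact: df.
  have df2 : differentiable f (x + c *: a) by have := df c 0 cs s00; rewrite scale0r addr0.
  rewrite deriveB; [|by apply: diff_derivable; exact: dsh|exact: diff_derivable].
  rewrite addrA; congr (_ - _).
  exact: derive_translate.
have b1 := inD c s cs sss.
have b2 := inD c 0 cs s00.
move: b2; rewrite scale0r addr0 mul0r addr0 => b2.
move: b1 b2; rewrite derive_lin//.
have -> : 'D_(c *: a) ('D_a f) x = c *: 'D_a ('D_a f) x.
  by rewrite !deriveE// linearZ.
have -> : 'D_(s *: b) ('D_a f) x = s *: 'D_b ('D_a f) x.
  by rewrite !deriveE// linearZ.
set A := 'D_a ('D_a f) x; set B := 'D_b ('D_a f) x => b1 b2.
have -> : f (x + s *: a + s *: b) - f (x + s *: a) - f (x + s *: b) + f x - s ^+ 2 * B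
   = s * (('D_a f (x + (c *: a + s *: b)) - 'D_a f x - (c *: A + s *: B)) -
          ('D_a f (x + c *: a) - 'D_a f x - c *: A)).
  have -> : f (x + s *: a + s *: b) - f (x + s *: a) - f (x + s *: b) + f x
    = phi (x + s *: a) - phi x by rewrite /phi; ring.
  by rewrite E Dphi /GRing.scale /=; ring.
rewrite normrM (gtr0_norm s0) expr2 mulrA mulrC ler_wpM2r ?(ltW s0)//.
apply: (le_trans (ler_normB _ _)); apply: (le_trans (lerD b1 b2)).
rewrite -mulrDr mulrAC ler_pdivrMr// -mulrA ler_wpM2l ?(ltW e0)//.
have /andP[c0 c1] := cs.
have : c * `|a| <= s * `|a| by rewrite ler_wpM2r.
rewrite /M; lra.
Unshelve. all: by end_near.
Qed.

Lemma second_difference_quotient (p q r u A B e t : R) : 0 < t ->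
  `|p - q - r + u - t * B| <= e / 2 * t -> `|p - r - q + u - t * A| <= e / 2 * t ->
  `|A - B| <= e.
Proof.
move=> t0 h1 h2; rewrite -(ler_pM2r t0) -[X in _ * X <= _](gtr0_norm t0) -normrM.
have := le_trans (ler_normB _ _) (lerD h1 h2).
rewrite -mulrDl -splitr; apply: le_trans; rewrite le_eqVlt; apply/orP; left; apply/eqP.
by congr `|_|; ring.
Qed.

(** The second difference is symmetric in [a] and [b], so both iterated
   derivatives are its limit after division by s^2. *)
Lemma schwarz (U : set V) (f : V -> R^o) x a b : open U ->
  smooth_on U f -> U x -> 'D_a ('D_b f) x = 'D_b ('D_a f) x.
Proof.
move=> oU sf Ux; apply/eqP; rewrite -subr_eq0 -normr_le0; apply/ler_addgt0Pr => e e0.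
rewrite add0r.
have e2 : 0 < e / 2 by rewrite divr_gt0.
have E1 := second_difference a b oU sf Ux e2.
have E2 := second_difference b a oU sf Ux e2.
near (0 : R)^'+ => s.
have s0 : 0 < s by near: s; exact: nbhs_right_gt.
have h1 := near E1 s; have h2 := near E2 s.
have s2 : 0 < s ^+ 2 by rewrite exprn_gt0.
have h2' := h2 _; rewrite [x + s *: b + s *: a]addrAC in h2'.
by apply: (second_difference_quotient s2 (h1 _) (h2' _)).
Unshelve. all: by end_near.
Qed.

End Schwarz.

(** Parallel transport only controls a curve on an interval to the right of 0;
   for a differentiable function this determines the derivative at 0. *)
Lemma derive_right0 (R : realType) (W : normedModType R) (f : R^o -> W) (tau : R) :
  0 < tau -> differentiable f 0 -> (forall t, 0 <= t <= tau -> f t = 0) ->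
  'D_(1 : R^o) f 0 = 0.
Proof.
move=> tau0 df f0; apply/eqP; rewrite -normr_le0; apply/ler_addgt0Pr => e e0.
rewrite add0r; have /nbhs_normP[d /= d0 hd] := differentiable_bound df e0.
pose t := Num.min tau (d / 2).
have t0 : 0 < t by rewrite lt_min tau0 divr_gt0.
have td : t < d by rewrite gt_min; apply/orP; right; move: d0; lra.
have := hd (t : R^o); rewrite /= sub0r normrN (gtr0_norm t0) => /(_ td).
rewrite add0r !f0 ?lexx ?(ltW tau0)//; last by rewrite (ltW t0) ge_min lexx.
have -> : 'D_t f 0 = t *: 'D_(1 : R^o) f 0.
  rewrite !deriveE// -linearZ; congr ('d f 0 _); by rewrite [t *: 1]mulr1.
rewrite subrr sub0r normrN normrZ (gtr0_norm t0) mulrC.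
by rewrite ler_pM2r.
Qed.

Lemma smooth_line (R : realType) m (x v : 'rV[R]_m) (I : set R^o) : open I ->
  smooth_on I (fun t : R^o => x + t *: v).
Proof.
move=> oI; apply/(smooth_rowP _ oI) => i.
have s1 : smooth_on I (fun t : R^o => x 0 i + t * v 0 i : R^o).
  apply: (smoothD oI); first exact: smooth_cst.
  by apply: (smoothM oI); [exact: smooth_id|exact: smooth_cst].
by apply: (smooth_on_eq oI) s1 => t _; rewrite !mxE.
Qed.

Lemma linear_row_expand (R : realType) m (f : 'rV[R]_m -> R^o) (x : 'rV[R]_m) : linear f ->
  f x = \sum_i x 0 i * f (delta_mx 0 i).
Proof.
move=> lf; pose L : {linear 'rV[R]_m -> R^o} := HB.pack f (GRing.isLinear.Build _ _ _ _ _ lf).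
rewrite -[f x]/(L x) {1}(row_sum_delta x) linear_sum; apply: eq_bigr => i _; exact: linearZ.
Qed.

(** Product rule for a bilinear form with varying coefficients, evaluated on two
   varying vectors. *)
Lemma is_derive_trilinear_sum (R : realType) m (u v : 'I_m -> R^o -> R^o) (w : 'I_m -> 'I_m -> R^o -> R^o)
    (du dv : 'I_m -> R) (dw : 'I_m -> 'I_m -> R) (t : R^o) :
  (forall i, is_derive t (1 : R^o) (u i) (du i)) ->
  (forall i, is_derive t (1 : R^o) (v i) (dv i)) ->
  (forall i j, is_derive t (1 : R^o) (w i j) (dw i j)) ->
  is_derive t (1 : R^o) (fun s => \sum_i \sum_j u i s * (v j s * w i j s) : R^o)
   (\sum_i \sum_j (u i t * (v j t * dw i j) + du i * (v j t * w i j t) + u i t * (dv j * w i j t))).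
Proof.
move=> hu hv hw.
have -> : (fun s => \sum_i \sum_j u i s * (v j s * w i j s) : R^o) =
    \sum_i \sum_j (u i * (v j * w i j)).
  apply/funext => s; rewrite fct_sumE; apply: eq_bigr => i _.
  by rewrite fct_sumE.
apply: is_derive_sum => i; apply: is_derive_sum => j.
have h1 := is_deriveM (hv j) (hw i j).
apply: (is_derive_eq (is_deriveM (hu i) h1)).
by rewrite /GRing.scale /= !fctE; ring.
Qed.

Lemma derive_subr_cst (R : realType) (V W : normedModType R) (f : V -> W) (C : W) x v :
  derivable f x v -> 'D_v (fun y => f y - C) x = 'D_v f x.
Proof.
move=> df; have dC : derivable (cst C : V -> W) x v by exact: derivable_cst.
by rewrite (deriveB df dC) derive_cst subr0.
Qed.

Lemma open_preimage_within (T U : topologicalType) (O : set T) (O' : set U) (f : T -> U) :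
  open O -> open O' -> (forall x, O x -> {for x, continuous f}) -> open (O `&` f @^-1` O').
Proof.
move=> oO oO' cf; rewrite openE => x [Ox fx]; apply: filterI.
  exact: (open_nbhs_nbhs (conj oO Ox)).
by apply: (cf x Ox); exact: (open_nbhs_nbhs (conj oO' fx)).
Qed.

(** * Hadamard's lemma *)

Section UnitIntegral.
Context {R : realType}.

Definition integral01 (f : R -> R) : R := \int[@lebesgue_measure R]_(s in `[0, 1]) f s.

Lemma integrable01 (f : R -> R) : continuous f ->
  (@lebesgue_measure R).-integrable `[0%R, 1%R] (EFin \o f).
Proof.
move=> cf; apply: continuous_compact_integrable; first exact: segment_compact.
exact: continuous_subspaceT.
Qed.

Lemma integral01D (f g : R -> R) : continuous f -> continuous g ->
  integral01 (fun s => f s + g s) = integral01 f + integral01 g.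
Proof. by move=> cf cg; rewrite /integral01 RintegralD//; exact: integrable01. Qed.

Lemma integral01Z (k : R) (f : R -> R) : continuous f ->
  integral01 (fun s => k * f s) = k * integral01 f.
Proof. by move=> cf; rewrite /integral01 RintegralZl//; exact: integrable01. Qed.

Lemma integral01_cst (s : R) : integral01 (fun=> s) = s.
Proof.
by rewrite /integral01 Rintegral_cst//= lebesgue_measure_itv /= lte_fin ltr01 oppr0 adde0 mulr1.
Qed.

Lemma integral01_bound (f : R -> R) (C : R) : continuous f ->
  (forall s, 0 <= s <= 1 -> `|f s| <= C) -> `|integral01 f| <= C.
Proof.
move=> cf h; apply: le_trans (le_normr_Rintegral _ (integrable01 cf)) _ => //.
rewrite -[leRHS]integral01_cst.
apply: le_Rintegral => //.
- apply: integrable01 => s; apply: continuous_comp; [exact: cf|exact: norm_continuous].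
- apply: integrable01; exact: cst_continuous.
Qed.

Lemma integral01_derive (F f : R^o -> R^o) : continuous f ->
  (forall s : R^o, is_derive s (1 : R^o) F (f s)) -> integral01 f = F 1 - F 0.
Proof.
move=> cf dF; rewrite /integral01 /Rintegral.
have cF : continuous F.
  move=> s; apply: differentiable_continuous; apply/derivable1_diffP.
  by have [] := dF s.
rewrite (@continuous_FTC2 R f F 0 1)//.
- exact: continuous_subspaceT.
- split; [by move=> s _; have [] := dF s|..].
    by apply: cvg_at_right_filter; exact: cF.
  by apply: cvg_at_left_filter; exact: cF.
- by move=> s _; rewrite derive1E; have [] := dF s.
Qed.

End UnitIntegral.

Section Hadamard.
Context {R : realType} {N : nat}.
Local Notation E := 'rV[R]_N.
Implicit Types (f : E -> R^o) (x y z h : E).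

Lemma coord_le_norm h i : `|h 0 i| <= `|h|.
Proof.
rewrite [leRHS]/Num.Def.normr/= mx_normrE.
exact: (le_bigmax (0%R : R) (fun ij => `|h ij.1 ij.2|) (0, i)).
Qed.

Lemma derive_coords f y h : differentiable f y ->
  'D_h f y = \sum_i h 0 i * 'D_(delta_mx 0 i) f y.
Proof. by move=> df; rewrite {1}(row_sum_delta h) derive_sumdir. Qed.

(** By the mean value theorem and continuity of the partial derivatives, the
   first order expansion at [y] is uniform for [y] near [z]. *)
Lemma smooth_strict_diff f z (e : R) : smooth_on setT f -> 0 < e ->
  \forall y \near z & h \near (0 : E), `|f (y + h) - f y - 'D_h f y| <= e * `|h|.
Proof.
move=> sf e0.
have df y : differentiable f y by exact: smooth_on_differentiable sf _.
pose e' := e / (2 * N.+1%:R).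
have e'0 : 0 < e' by rewrite divr_gt0// mulr_gt0.
have gc i : \forall y \near z, `|'D_(delta_mx 0 i) f y - 'D_(delta_mx 0 i) f z| <= e'.
  have /differentiable_continuous c := smooth_on_differentiable (smooth_on_derive (delta_mx 0 i) sf) (I : setT z).
  by move/cvgrPdist_le : c => /(_ e' e'0); apply: filterS => y; rewrite distrC.
have /nbhs_normP[d /= d0 hd] := filter_forall (nbhs_filter z) gc.
have d2 : 0 < d / 2 by rewrite divr_gt0.
have Y : \forall y \near z, `|z - y| < d / 2 by apply/nbhs_normP; exists (d / 2).
have H0 : \forall h \near (0 : E), `|h| < d / 2.
  by apply/nbhs_normP; exists (d / 2) => // h /=; rewrite sub0r normrN.
near=> y h => /=.
have yz : `|z - y| < d / 2 by near: y.
have hs : `|h| < d / 2 by near: h.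
have [c cs Emvt] := @mvt_line R E f y h 1 ltr01 (fun t _ => df _).
rewrite scale1r mulr1 in Emvt; rewrite Emvt !derive_coords// -sumrB.
apply: (le_trans (ler_norm_sum _ _ _)).
apply: (@le_trans _ _ (\sum_(i < N) (`|h| * (e' + e')))).
  apply: ler_sum => i _; rewrite -mulrBr normrM ler_pM// ?coord_le_norm//.
  rewrite -(subrKA ('D_(delta_mx 0 i) f z)); apply: (le_trans (ler_normD _ _)).
  apply: lerD.
    apply: hd => /=; rewrite opprD addrA; apply: (le_lt_trans (ler_normB _ _)).
    rewrite (splitr d) ltr_leD// (le_trans _ (ltW hs))// normrZ.
    by have /andP[c0 c1] := cs; rewrite (ger0_norm c0) ler_piMl.
  rewrite distrC; apply: hd => /=; apply: (lt_le_trans yz).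
  by move: d0; lra.
have -> : e' + e' = e / N.+1%:R by rewrite /e'; field; rewrite nat1r pnatr_eq0.
rewrite sumr_const card_ord -mulrnAr mulrC ler_wpM2r// -mulr_natr mulrAC.
by rewrite ler_pdivrMr// ler_wpM2l ?(ltW e0)// ler_nat.
Unshelve. all: by end_near.
Qed.

(** Strict differentiability at the points of the segment from 0 to [x], made
   uniform along the segment by compactness of [0, 1]. This is what justifies
   differentiation under the integral sign. *)
Lemma smooth_segment_diff f x (e : R) : smooth_on setT f -> 0 < e ->
  \forall h \near (0 : E), forall s : R, 0 <= s <= 1 ->
    `|f (s *: x + s *: h) - f (s *: x) - 'D_(s *: h) f (s *: x)| <= e * `|h|.
Proof.
move=> sf e0.
have /compact_near_coveringP cov := @segment_compact R 0 1.
have H (s : R) : `[0, 1]%classic s -> \forall s' \near s & h \near (0 : E),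
   `|f (s' *: x + s' *: h) - f (s' *: x) - 'D_(s' *: h) f (s' *: x)| <= e * `|s' *: h|.
  move=> _; have Hs := smooth_strict_diff (s *: x) sf e0.
  have C1 : (p.1 *: x) @[p --> (s, (0 : E))] --> s *: x.
    by apply: cvgZr_tmp; exact: cvg_fst.
  have C2 : (p.1 *: p.2) @[p --> (s, (0 : E))] --> (0 : E).
    rewrite -[X in _ --> X](scaler0 _ s); apply: cvgZ; [exact: cvg_fst|exact: cvg_snd].
  exact: (cvg_pair C1 C2 Hs).
have K0 := cov _ (nbhs (0 : E)) (fun h s => `|f (s *: x + s *: h) - f (s *: x) - 'D_(s *: h) f (s *: x)| <= e * `|s *: h|) (nbhs_filter (0 : E)) H.
apply: filterS K0 => h hh s s01.
apply: le_trans (hh s _) _; first by rewrite /= in_itv.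
rewrite ler_wpM2l ?(ltW e0)// normrZ; have /andP[s0 s1] := s01.
by rewrite (ger0_norm s0) ler_piMl.
Qed.

(** The weight s^k is there because differentiating f(s x) in x produces a
   factor s; the family over all [k] and [f] is then closed under
   derivatives. *)
Definition radial_mean (k : nat) f (x : E) : R^o :=
  integral01 (fun s => s ^+ k * f (s *: x)).

Lemma continuous_radial (k : nat) f x : smooth_on setT f ->
  continuous (fun s : R => s ^+ k * f (s *: x)).
Proof.
move=> sf s; apply: cvgM.
  exact: exprn_continuous.
apply: (@continuous_comp _ _ _ (fun s : R => s *: x) f).
  exact: scalel_continuous.
by apply: differentiable_continuous; exact: smooth_on_differentiable sf _.
Qed.

Lemma radial_mean_linear k f x : smooth_on setT f ->
  linear (fun h => radial_mean k ('D_h f) x : R^o).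
Proof.
move=> sf a u v; rewrite /radial_mean.
have c h := @continuous_radial k _ x (smooth_on_derive h sf).
have -> : (fun s => s ^+ k * 'D_(a *: u + v) f (s *: x)) =
    (fun s => a * (s ^+ k * 'D_u f (s *: x)) + s ^+ k * 'D_v f (s *: x)).
  apply/funext => s; rewrite derive_lin; last exact: smooth_on_differentiable sf _.
  by rewrite /GRing.scale /=; ring.
rewrite integral01D ?integral01Z//.
by move=> s; apply: cvgM; [exact: cvg_cst|exact: c].
Qed.

(** Integrate the uniform expansion of [smooth_segment_diff] over [0, 1]. *)
Lemma radial_mean_diff k f x : smooth_on setT f ->
  differentiable (radial_mean k f) x /\ forall h, 'D_h (radial_mean k f) x = radial_mean k.+1 ('D_h f) x.
Proof.
move=> sf.
pose L : {linear E -> R^o} := HB.pack (fun h => radial_mean k.+1 ('D_h f) x : R^o)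
  (GRing.isLinear.Build _ _ _ _ _ (@radial_mean_linear k.+1 f x sf)).
have cL : continuous L.
  have -> : (L : E -> R^o) = \sum_(i < N) (fun h : E => h 0 i *: L (delta_mx 0 i)).
    apply/funext => h; rewrite {1}(row_sum_delta h) linear_sum.
    elim/big_ind2 : _ => // [? ? ? ? -> -> //|i _]; exact: linearZ.
  move=> h; apply: differentiable_continuous; apply: differentiable_sum => i.
  apply: differentiableZl; exact: differentiable_coord.
apply: (differentiable_of_bound cL) => e e0; have := smooth_segment_diff x sf e0.
apply: filterS => h hh /=.
have c y := @continuous_radial k f y sf.
have cD : continuous (fun s : R => s ^+ k.+1 * 'D_h f (s *: x)).
  exact: (@continuous_radial k.+1 _ x (smooth_on_derive h sf)).
have cM (g : R -> R) (a : R) : continuous g -> continuous (fun s => a * g s).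
  by move=> cg s; apply: cvgM; [exact: cvg_cst|exact: cg].
have cA (g g' : R -> R) : continuous g -> continuous g' -> continuous (fun s => g s + g' s).
  by move=> cg cg' s; apply: cvgD; [exact: cg|exact: cg'].
have -> : radial_mean k f (x + h) - radial_mean k f x - radial_mean k.+1 ('D_h f) x
  = integral01 (fun s => s ^+ k * f (s *: (x + h)) +
     (-1) * (s ^+ k * f (s *: x) + s ^+ k.+1 * 'D_h f (s *: x))).
  rewrite integral01D ?integral01Z ?integral01D//; first by rewrite mulN1r opprD addrA.
  - exact: cA.
  - by apply: cM; exact: cA.
apply: integral01_bound.
  by apply: (cA) => //; apply: cM; exact: cA.
move=> s s01; have := hh s s01; have /andP[s0 s1] := s01.
have -> : 'D_(s *: h) f (s *: x) = s * 'D_h f (s *: x).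
  by rewrite !deriveE ?linearZ//; exact: (sf [::]).
rewrite -scalerDr => hb.
set u := f (s *: (x + h)) in hb *; set w := f (s *: x) in hb *; set d := 'D_h f _ in hb *.
have -> : s ^+ k * u + -1 * (s ^+ k * w + s ^+ k.+1 * d) = s ^+ k * (u - w - s * d).
  by rewrite exprS; ring.
rewrite normrM (ger0_norm (exprn_ge0 _ s0)).
by apply: le_trans hb; rewrite ler_piMl// exprn_ile1.
Qed.

Lemma smooth_radial_mean k f : smooth_on setT f -> smooth_on setT (radial_mean k f).
Proof.
move=> sf; apply/smooth_onP => m; elim: m k f sf => [|m IH] k f sf.
  by split=> // x _; have [] := @radial_mean_diff k f x sf.
split=> [x _|v]; first by have [] := @radial_mean_diff k f x sf.
have -> : 'D_v (radial_mean k f) = radial_mean k.+1 ('D_v f).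
  by apply/funext => x; have [_] := @radial_mean_diff k f x sf.
by apply: IH; exact: smooth_on_derive.
Qed.

(** f(x) - f(0) is the integral over [0, 1] of the derivative of s |-> f(s x).
   The quotients are again smooth, which is the point of the lemma: a derivation
   can be applied to the products. *)
Lemma hadamard f x : smooth_on setT f ->
  f x = f 0 + \sum_i x 0 i * radial_mean 0 ('D_(delta_mx 0 i) f) x.
Proof.
move=> sf; have df y : differentiable f y by exact: smooth_on_differentiable sf _.
have H : integral01 (fun s => 'D_x f (s *: x)) = f (1 *: x) - f (0 *: x).
  apply: (@integral01_derive R (fun s : R^o => f (s *: x))).
    move=> s; apply: (@continuous_comp _ _ _ (fun s : R => s *: x) ('D_x f)).
      exact: scalel_continuous.
    by apply: differentiable_continuous; exact: smooth_on_differentiable (smooth_on_derive x sf) _.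
  move=> s; have := @derive_along_line R E R^o f 0 x s.
  rewrite add0r; under eq_fun do rewrite add0r; exact.
rewrite scale1r scale0r in H.
rewrite -[f x](subrKC (f 0)) -H; congr (_ + _).
pose L : {linear E -> R^o} := HB.pack (fun h => radial_mean 0 ('D_h f) x : R^o)
  (GRing.isLinear.Build _ _ _ _ _ (@radial_mean_linear 0 f x sf)).
have -> : integral01 (fun s => 'D_x f (s *: x)) = L x.
  by rewrite /= /radial_mean; congr integral01; apply/funext => s; rewrite expr0 mul1r.
rewrite {1}(row_sum_delta x) linear_sum; apply: eq_bigr => i _; exact: linearZ.
Qed.

End Hadamard.

(** * Charts, smooth functions and cutoffs on a manifold *)

Section Charts.
Context {R : realType} {M : Type} {n : nat}.
Implicit Types (c d k : chart R M n) (p q : M) (f : M -> R).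

Definition cimg k : set 'rV[R]_n := cfwd k @` cdom k.

Lemma open_cimg k : open (cimg k). Proof. exact: chart_open. Qed.

Lemma cimg_fwd k p : cdom k p -> cimg k (cfwd k p).
Proof. by move=> kp; exists p. Qed.

Lemma cdom_bwd k z : cimg k z -> cdom k (cbwd k z).
Proof. by move=> [q kq <-]; rewrite chartK. Qed.

Lemma cbwdK k z : cimg k z -> cfwd k (cbwd k z) = z.
Proof. by move=> [q kq <-]; rewrite chartK. Qed.

Lemma cimg_subP k (U : set M) z :
  (cfwd k @` (cdom k `&` U)) z <-> cimg k z /\ U (cbwd k z).
Proof.
split=> [[q [kq Uq] <-]|[kz Uz]]; first by split; [exact: cimg_fwd|rewrite chartK].
by exists (cbwd k z); [split=> //; exact: cdom_bwd|exact: cbwdK].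
Qed.

(** Composition with the transition map carries smoothness near a point from one
   chart to another, independently of the function. *)
Lemma smooth_transition c k (J : set 'rV[R]_n) p : chart_compat c k -> open J ->
  cdom c p -> cdom k p -> J (cfwd k p) ->
  exists J' : set 'rV[R]_n, [/\ open J', J' (cfwd c p),
    forall z, J' z -> [/\ cimg c z, cdom k (cbwd c z) & J (cfwd k (cbwd c z))] &
    forall f, smooth_on J (f \o cbwd k : _ -> R^o) -> smooth_on J' (f \o cbwd c : _ -> R^o)].
Proof.
move=> [ oO sO] oJ cp kp Jp.
set O := cfwd c @` _ in oO sO; set t := cfwd k \o cbwd c in sO.
have oJ' : open (O `&` t @^-1` J).
  apply: open_preimage_within => // x Ox.
  by apply: differentiable_continuous; exact: smooth_on_differentiable sO Ox.
exists (O `&` t @^-1` J); split=> //.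
- split; first by exists p.
  by rewrite /t /= chartK.
- by move=> z [/cimg_subP[cz kz] Jz]; split.
- move=> f sf.
  have : smooth_on (O `&` t @^-1` J) ((f \o cbwd k : _ -> R^o) \o t).
    apply: (smooth_comp oJ' _ sf) => [|x []//].
    exact: smooth_on_sub sO.
  apply: (smooth_on_eq oJ') => z [/cimg_subP[cz kz] Jz].
  by rewrite /t /= chartK.
Qed.

End Charts.

Section Manifold.
Context {R : realType} {M : Type} {n : nat} (A : manifold R M n).
Implicit Types (c d k : chart R M n) (p q : M) (f : M -> R).

(** Compatibility with the atlas rather than membership: the local
   trivializations of a bundle are only given as such charts of the total
   space. *)
Definition adapted k := forall d, atlas A d -> chart_compat k d /\ chart_compat d k.

Lemma atlas_adapted c : atlas A c -> adapted c.
Proof. by move=> Ac d Ad; split; exact: (@atlas_compat _ _ _ A). Qed.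

Lemma atlas_chart_at p : exists2 c, atlas A c & cdom c p.
Proof.
have [At [_ sub cov]] := atlas_countable A; have [c Atc cp] := cov p.
by exists c => //; exact: sub.
Qed.

Lemma mopen_adapted k (U : set M) : adapted k -> mopen A U ->
  open (cfwd k @` (cdom k `&` U)).
Proof.
move=> ak oU; rewrite openE => z [q [kq Uq] <-].
have [d Ad dq] := atlas_chart_at q.
have [J [oJ Jq JP _]] := smooth_transition (ak d Ad).1 (oU d Ad) kq dq (ex_intro2 _ _ q (conj dq Uq) erefl).
apply: filterS (open_nbhs_nbhs (conj oJ Jq)) => y /JP[ky dy /cimg_subP[_ Uy]].
by apply/cimg_subP; split=> //; rewrite -(chartK dy).
Qed.

Lemma mopenT : mopen A setT.
Proof. by move=> c _; rewrite setIT; exact: chart_open. Qed.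

Lemma mopenI U V : mopen A U -> mopen A V -> mopen A (U `&` V).
Proof.
move=> oU oV c Ac.
have -> : cfwd c @` (cdom c `&` (U `&` V)) =
    (cfwd c @` (cdom c `&` U)) `&` (cfwd c @` (cdom c `&` V)).
  apply/seteqP; split=> z; first by move=> /cimg_subP[cz [Uz Vz]]; split; apply/cimg_subP.
  by move=> [/cimg_subP[cz Uz] /cimg_subP[_ Vz]]; apply/cimg_subP.
by apply: openI; [exact: oU|exact: oV].
Qed.

Definition smooth_at f p := exists k J, [/\ adapted k, cdom k p, open J, J (cfwd k p) &
  smooth_on J (f \o cbwd k : _ -> R^o)].

Lemma smooth_at_fun f : (forall p, smooth_at f p) -> smooth_fun A f.
Proof.
move=> h c Ac; apply: smooth_on_loc => z [p [cp _] <-].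
have [k [J [ak kp oJ Jp sJ]]] := h p.
have [J' [oJ' J'p _ sJ']] := smooth_transition (ak c Ac).2 oJ cp kp Jp.
by exists J' => //; exact: sJ'.
Qed.

Lemma smooth_fun_chart f k : adapted k -> smooth_fun A f ->
  smooth_on (cimg k) (f \o cbwd k : _ -> R^o).
Proof.
move=> ak sf; apply: smooth_on_loc => z [p kp <-].
have [d Ad dp] := atlas_chart_at p.
have oD := mopenT Ad.
have [J [oJ Jp _ sJ]] := smooth_transition (ak d Ad).1 oD kp dp (ex_intro2 _ _ p (conj dp I) erefl).
by exists J => //; apply: sJ; exact: sf.
Qed.

Lemma smooth_fun_at f p k : adapted k -> cdom k p -> smooth_fun A f ->
  differentiable (f \o cbwd k : _ -> R^o) (cfwd k p).
Proof.
by move=> ak kp sf; exact: smooth_on_differentiable (smooth_fun_chart ak sf) (cimg_fwd kp).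
Qed.

Lemma smooth_fun_cst (s : R) : smooth_fun A (fun=> s).
Proof.
apply: smooth_at_fun => p; have [d Ad dp] := atlas_chart_at p.
exists d, (cimg d); split=> //; [exact: atlas_adapted|exact: open_cimg|exact: cimg_fwd|].
exact: (@smooth_cst R _ R^o (cimg d) s).
Qed.

Lemma smooth_funD f g : smooth_fun A f -> smooth_fun A g -> smooth_fun A (fun q => f q + g q).
Proof.
move=> sf sg; apply: smooth_at_fun => p; have [d Ad dp] := atlas_chart_at p.
have ad := atlas_adapted Ad.
exists d, (cimg d); split=> //; [exact: open_cimg|exact: cimg_fwd|].
exact: (smoothD (open_cimg (k:=d)) (smooth_fun_chart ad sf) (smooth_fun_chart ad sg)).
Qed.

Lemma smooth_funM f g : smooth_fun A f -> smooth_fun A g -> smooth_fun A (fun q => f q * g q).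
Proof.
move=> sf sg; apply: smooth_at_fun => p; have [d Ad dp] := atlas_chart_at p.
have ad := atlas_adapted Ad.
exists d, (cimg d); split=> //; [exact: open_cimg|exact: cimg_fwd|].
exact: (smoothM (open_cimg (k:=d)) (smooth_fun_chart ad sf) (smooth_fun_chart ad sg)).
Qed.

Lemma smooth_funlin (s : R) f g : smooth_fun A f -> smooth_fun A g ->
  smooth_fun A (fun q => s * f q + g q).
Proof.
by move=> sf sg; apply: (smooth_funD (smooth_funM _ sf) sg); exact: smooth_fun_cst.
Qed.

(** By the Hausdorff property each point of the compact set is separated from
   [q], and finitely many of these separations suffice. Compact subsets of a
   chart are thus closed in the manifold, which is why extensions by zero are
   smooth. *)
Lemma compact_separation k (K : set 'rV[R]_n) q : adapted k -> compact K -> K `<=` cimg k ->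
  ~ (cbwd k @` K) q ->
  exists W, [/\ mopen A W, W q & forall z, K z -> ~ W (cbwd k z)].
Proof.
move=> ak cK Kk qK.
(* The neighborhood filter of q in the topology of the atlas, to be used with
   the filter form of compactness. *)
pose F : set_system M := fun W => exists O, [/\ mopen A O, O q & O `<=` W].
have FF : Filter F.
  split.
  - by exists setT; split=> //; exact: mopenT.
  - move=> P Q [ O [ oO Oq OP]] [ O' [ oO' O'q O'Q]]; exists (O `&` O'); split=> //.
      exact: mopenI.
    by move=> x [/OP Px /O'Q Qx].
  - by move=> P Q PQ [ O [ oO Oq OP]]; exists O; split=> // x /OP /PQ.
have /compact_near_coveringP cov := cK.
have H z : K z -> \forall z' \near z & q' \near F, cimg k z' -> cbwd k z' <> q'.
  move=> Kz; have zq : cbwd k z <> q by move=> E; apply: qK; exists z.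
  have [ O [ O' [ oO oO' Oz O'q OO']]] := atlas_hausdorff A zq.
  have oO1 := mopen_adapted ak oO.
  exists (cfwd k @` (cdom k `&` O), O').
    split; last by exists O'; split.
    apply: (open_nbhs_nbhs (conj oO1 _)); apply/cimg_subP; split=> //; exact: Kk.
  move=> [z' q'] [/= /cimg_subP[kz' Oz'] O'q'] _ E.
  have : (O `&` O') q' by split=> //; rewrite -E.
  by rewrite OO'.
have [ O [ oO Oq Osub]] := cov _ F (fun q' z' => cimg k z' -> cbwd k z' <> q') FF H.
by exists O; split=> // z Kz Oz; apply: (Osub _ Oz z Kz) => //; exact: Kk.
Qed.

(** The last property packages extension by zero: multiplication by [psi] turns
   a function that is smooth in the chart into a global smooth function,
   whatever its values outside of the chart. The hypotheses of the connection
   only speak of global functions and fields, so every local construction goes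
   through this lemma. *)
Lemma cutoff k p (O : set 'rV[R]_n) : adapted k -> cdom k p -> open O -> O (cfwd k p) ->
  O `<=` cimg k -> exists psi : M -> R, [/\
    exists J, [/\ open J, J (cfwd k p), J `<=` O & forall z, J z -> psi (cbwd k z) = 1],
    forall q, psi q <> 0 -> cdom k q /\ O (cfwd k q) &
    forall f, smooth_on O (f \o cbwd k : _ -> R^o) -> smooth_fun A (fun q => psi q * f q)].
Proof.
move=> ak kp oO Op Ok.
have [b [K [J [sb [cK _] KO [oJ Jz JK b1] bK]]]] := bump_in oO Op.
pose psi q := if `[< cdom k q >] then b (cfwd k q) else 0.
have psiz z : cimg k z -> psi (cbwd k z) = b z.
  by move=> kz; rewrite /psi asboolT ?cbwdK//; exact: cdom_bwd.
have psi0 q : psi q <> 0 -> cdom k q /\ K (cfwd k q).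
  by rewrite /psi; case: asboolP => // kq bq; split=> //; exact: bK.
exists psi; split.
- exists J; split=> // [z /JK/KO //|z Jz'].
  by rewrite psiz ?b1//; exact/Ok/KO/JK.
- by move=> q /psi0[kq Kq]; split=> //; exact: KO.
- move=> f sf; apply: smooth_at_fun => q.
  have [[kq Kq]|nK] := pselect (cdom k q /\ K (cfwd k q)).
    exists k, O; split=> //; first exact: KO.
    apply: (smooth_on_eq oO) (smoothM oO (smooth_on_sub _ sb) sf) => // z Oz.
    by rewrite /= psiz//; exact: Ok.
  have [|W [oW Wq WK]] := compact_separation ak cK (subset_trans KO Ok) (q := q).
    by move=> [z Kz E]; apply: nK; rewrite -E; split; [apply/cdom_bwd/Ok/KO|rewrite cbwdK//; exact/Ok/KO].
  have [c Ac cq] := atlas_chart_at q.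
  exists c, (cfwd c @` (cdom c `&` W)); split=> //.
  + exact: atlas_adapted.
  + exact: oW.
  + by exists q.
  + apply: (smooth_on_eq (oW c Ac)) (@smooth_cst R _ R^o _ 0) => z /cimg_subP[cz Wz].
    rewrite /=; suff -> : psi (cbwd c z) = 0 by rewrite mul0r.
    by apply: contrapT => /psi0[kz Kz]; apply: (WK _ Kz); rewrite chartK.
Qed.

End Manifold.

(** * Tangent vectors in a chart *)

Section Tangent.
Context {R : realType} {M : Type} {n : nat} (A : manifold R M n).
Implicit Types (c d k : chart R M n) (p q : M) (f : M -> R) (a b : 'rV[R]_n).

Lemma tnormalizeE (v : tvec R M) f : smooth_fun A f -> tnormalize A v f = v f.
Proof. by move=> sf; rewrite /tnormalize asboolT. Qed.

Lemma tnormalize_out (v : tvec R M) f : ~ smooth_fun A f -> tnormalize A v f = 0.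
Proof. by move=> sf; rewrite /tnormalize asboolF. Qed.

Lemma tnormalize_eq (v w : tvec R M) : (forall f, smooth_fun A f -> v f = w f) ->
  tnormalize A v = tnormalize A w.
Proof. by move=> vw; apply/funext => f; rewrite /tnormalize; case: asboolP => // /vw. Qed.

Definition coordvec k p a : tvec R M :=
  tnormalize A (fun f => 'D_a (f \o cbwd k : _ -> R^o) (cfwd k p)).

Lemma coordvecE k p a f : smooth_fun A f ->
  coordvec k p a f = 'D_a (f \o cbwd k : _ -> R^o) (cfwd k p).
Proof. exact: tnormalizeE. Qed.

Lemma coordvec_linear k p : adapted A k -> cdom k p -> linear (coordvec k p).
Proof.
move=> ak kp s a b; apply/funext => f; rewrite !fctE.
have [sf|nf] := pselect (smooth_fun A f); last by rewrite /coordvec !tnormalize_out// scaler0 addr0.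
by rewrite !coordvecE// derive_lin//; exact: smooth_fun_at sf.
Qed.

Lemma coordvecD k p a b : adapted A k -> cdom k p ->
  coordvec k p (a + b) = coordvec k p a + coordvec k p b.
Proof.
by move=> ak kp; have := coordvec_linear ak kp 1 a b; rewrite !scale1r.
Qed.

Lemma coordvec0 k p : adapted A k -> cdom k p -> coordvec k p 0 = 0.
Proof.
move=> ak kp; have := coordvec_linear ak kp (-1) 0 0.
by rewrite scaler0 addr0 => E; rewrite [LHS]E scaleN1r addNr.
Qed.

Lemma coordvec_tangent k p a : adapted A k -> cdom k p -> tangent_space A p (coordvec k p a).
Proof.
move=> ak kp; split.
- move=> s f g sf sg; rewrite !coordvecE//; last exact: smooth_funlin.
  have df := smooth_fun_at ak kp sf; have dg := smooth_fun_at ak kp sg.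
  have -> : (fun q => s * f q + g q) \o cbwd k = s \*: (f \o cbwd k : _ -> R^o) + (g \o cbwd k : _ -> R^o) by [].
  rewrite deriveD; [|apply: derivableZ|]; [|exact: diff_derivable..].
  by rewrite deriveZ//; exact: diff_derivable.
- move=> f g sf sg; rewrite !coordvecE//; last exact: smooth_funM.
  have df := smooth_fun_at ak kp sf; have dg := smooth_fun_at ak kp sg.
  have -> : (fun q => f q * g q) \o cbwd k = (f \o cbwd k : _ -> R^o) * (g \o cbwd k : _ -> R^o) by [].
  rewrite deriveM; [|exact: diff_derivable..].
  by rewrite /= chartK.
- by move=> f nf; rewrite /coordvec tnormalize_out.
Qed.

Section Derivation.
Variables (p : M) (v : tvec R M).
Hypothesis Tv : tangent_space A p v.

Lemma tangent_lin s f g : smooth_fun A f -> smooth_fun A g ->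
  v (fun q => s * f q + g q) = s * v f + v g.
Proof. by case: Tv => + _ _; exact. Qed.

Lemma tangentM f g : smooth_fun A f -> smooth_fun A g ->
  v (fun q => f q * g q) = f p * v g + g p * v f.
Proof. by case: Tv => _ + _; exact. Qed.

Lemma tangent0 : v (fun=> 0) = 0.
Proof.
have := tangent_lin (-1) (smooth_fun_cst 0) (smooth_fun_cst 0).
by rewrite mulr0 addr0 mulN1r addNr.
Qed.

Lemma tangent_cst s : v (fun=> s) = 0.
Proof.
have v1 : v (fun=> 1) = 0.
  have := tangentM (smooth_fun_cst 1) (smooth_fun_cst 1).
  rewrite mulr1 mul1r => /esym/eqP; rewrite -subr_eq0 addrK => /eqP; exact.
have := tangent_lin s (smooth_fun_cst 1) (smooth_fun_cst 0).
by rewrite v1 tangent0 mulr0 addr0 mulr1 addr0.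
Qed.

Lemma tangentD f g : smooth_fun A f -> smooth_fun A g ->
  v (fun q => f q + g q) = v f + v g.
Proof.
move=> sf sg; have := tangent_lin 1 sf sg; rewrite mul1r => <-.
by congr v; apply/funext => q; rewrite mul1r.
Qed.

Lemma tangent_sum m (f : 'I_m -> M -> R) : (forall i, smooth_fun A (f i)) ->
  v (fun q => \sum_i f i q) = \sum_i v (f i) /\ smooth_fun A (fun q => \sum_i f i q).
Proof.
elim: m f => [|m IH] f sf.
  rewrite big_ord0 (_ : (fun q => _) = fun=> 0); last by apply/funext => q; rewrite big_ord0.
  by split; [exact: tangent0|exact: smooth_fun_cst].
rewrite (_ : (fun q => _) = fun q => f ord0 q + \sum_(i < m) f (lift ord0 i) q); last first.
  by apply/funext => q; rewrite big_ord_recl.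
have [E S] := IH _ (fun i => sf (lift ord0 i)).
by rewrite big_ord_recl tangentD// E; split=> //; exact: smooth_funD.
Qed.

(** Derivations see germs only: multiply the difference of the two functions by
   a cutoff supported where they agree. *)
Lemma tangent_local k f g (J : set 'rV[R]_n) : adapted A k -> cdom k p ->
  open J -> J (cfwd k p) -> (forall z, J z -> cimg k z -> f (cbwd k z) = g (cbwd k z)) ->
  smooth_fun A f -> smooth_fun A g -> v f = v g.
Proof.
move=> ak kp oJ Jp fg sf sg.
have [psi [[J' [oJ' J'p _ psi1]] psi0 psiS]] := cutoff ak kp
  (openI oJ (open_cimg (k:=k))) (conj Jp (cimg_fwd kp)) (@subIsetr _ _ _).
have spsi : smooth_fun A psi.
  rewrite (_ : psi = fun q => psi q * 1); last by apply/funext => q; rewrite mulr1.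
  by apply: psiS; exact: (@smooth_cst R _ R^o _ 1).
have sN : smooth_fun A (fun q => -1 * g q + f q) by exact: smooth_funlin.
have : v (fun q => psi q * (-1 * g q + f q)) = 0.
  rewrite -[RHS]tangent0; congr v; apply/funext => q.
  have [/eqP ->|/eqP/psi0[kq [Jq _]]] := boolP (psi q == 0); first by rewrite mul0r.
  have := fg _ Jq (cimg_fwd kq); rewrite chartK// => ->.
  by rewrite mulN1r addNr mulr0.
rewrite tangentM// tangent_lin//.
have -> : psi p = 1 by rewrite -(chartK kp) psi1.
have -> : f p = g p by have := fg _ Jp (cimg_fwd kp); rewrite chartK.
rewrite mulN1r addNr mul0r addr0 mul1r mulN1r => /eqP.
by rewrite addrC subr_eq0 => /eqP.
Qed.

End Derivation.

(** Coordinates centered at [p], made global by a cutoff. *)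
Lemma coord_functions k p : adapted A k -> cdom k p -> exists X : 'I_n -> M -> R,
  (forall i, smooth_fun A (X i)) /\
  exists J, [/\ open J, J (cfwd k p), J `<=` cimg k &
    forall i z, J z -> X i (cbwd k z) = z 0 i - cfwd k p 0 i].
Proof.
move=> ak kp.
have [psi [[J [oJ Jp JO psi1]] psi0 psiS]] := cutoff ak kp (open_cimg (k:=k)) (cimg_fwd kp) (@subset_refl _ _).
exists (fun i q => psi q * (cfwd k q 0 i - cfwd k p 0 i)); split.
  move=> i; apply: psiS.
  have oI := open_cimg (k:=k).
  have s1 : smooth_on (cimg k) (fun z : 'rV[R]_n => z 0 i + (- cfwd k p 0 i) : R^o).
    apply: (smoothD oI); [exact: smooth_coord|exact: smooth_cst].
  by apply: (smooth_on_eq oI) s1 => z kz; rewrite /= cbwdK.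
exists J; split=> // i z Jz; rewrite psi1// mul1r cbwdK//; exact: JO.
Qed.

Lemma coord_function_coordvec k p (X : M -> R) i (J : set 'rV[R]_n) a : adapted A k -> cdom k p ->
  smooth_fun A X -> open J -> J (cfwd k p) ->
  (forall z, J z -> X (cbwd k z) = z 0 i - cfwd k p 0 i) -> coordvec k p a X = a 0 i.
Proof.
move=> ak kp sX oJ Jp EX; rewrite coordvecE//.
pose F (z : 'rV[R]_n) : R^o := z 0 i - cfwd k p 0 i.
have E : \forall z \near cfwd k p, F z = (X \o cbwd k) z.
  by apply: filterS (open_nbhs_nbhs (conj oJ Jp)) => z Jz; rewrite /= EX.
rewrite -(near_eq_derive _ E) /F.
have sI := @smooth_coord R n setT i.
have dI : derivable (fun z : 'rV[R]_n => z 0 i : R^o) (cfwd k p) a.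
  by apply: diff_derivable; exact: smooth_on_differentiable sI I.
rewrite (deriveD (f := fun z : 'rV[R]_n => z 0 i : R^o) (g := cst (- cfwd k p 0 i : R^o)))//.
rewrite derive_cst addr0 -(@derive_coord R _ n id (cfwd k p) a i); last by [].
by rewrite derive_id.
Qed.

Lemma coordvec_inj k p a : adapted A k -> cdom k p -> coordvec k p a = 0 -> a = 0.
Proof.
move=> ak kp E; have [X [sX [J [oJ Jp _ EX]]]] := coord_functions ak kp.
apply/rowP => i; rewrite -(coord_function_coordvec a ak kp (sX i) oJ Jp (EX i)) E.
by rewrite mxE.
Qed.

(** By Hadamard's lemma f = f(p) + sum_i X_i M_i near p, with X_i the centered
   coordinates and M_i smooth, M_i(p) being the i-th partial derivative of f; a
   derivation at p kills constants and maps X_i M_i to M_i(p) times its value on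
   X_i. *)
Lemma tangent_coordvec k p v : adapted A k -> cdom k p -> tangent_space A p v ->
  exists a, v = coordvec k p a.
Proof.
move=> ak kp Tv; set z0 := cfwd k p.
have oI := open_cimg (k:=k).
have [X [sX [J [oJ Jp JO EX]]]] := coord_functions ak kp.
exists (\row_i v (X i)); apply/funext => f.
have [sf|nf] := pselect (smooth_fun A f); last first.
  by rewrite /coordvec tnormalize_out//; case: Tv => _ _; exact.
rewrite coordvecE//.
(* Hadamard's lemma wants a function on the whole coordinate space, hence the
   extension beyond the chart. *)
have [g [sg [J' [oJ' J'p J'O Eg]]]] := smooth_extension oI (cimg_fwd kp) (smooth_fun_chart ak sf).
pose G (y : 'rV[R]_n) : R^o := g (y + z0).
have sG : smooth_on setT G.
  apply: (smooth_comp openT _ sg) => //.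
  by apply: (smoothD openT); [exact: smooth_id|exact: smooth_cst].
pose m i (y : 'rV[R]_n) : R^o := radial_mean 0 ('D_(delta_mx 0 i) G) y.
have sm i : smooth_on setT (m i) by exact/smooth_radial_mean/smooth_on_derive.
have [psi [[J2 [oJ2 J2p J2O psi1]] psi0 psiS]] := cutoff ak kp oI (cimg_fwd kp) (@subset_refl _ _).
pose Mi i (q : M) : R := psi q * m i (cfwd k q - z0).
have sMi i : smooth_fun A (Mi i).
  apply: psiS; have s1 : smooth_on (cimg k) (m i \o (fun z => z - z0)).
    apply: (smooth_comp oI _ (sm i)) => //.
    by apply: (smoothD oI); [exact: smooth_id|exact: smooth_cst].
  by apply: (smooth_on_eq oI) s1 => z kz; rewrite /= cbwdK.
have sXM i : smooth_fun A (fun q => X i q * Mi i q) by exact: smooth_funM.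
have [vS sS] := tangent_sum Tv sXM.
have EF : v f = v (fun q => f p + \sum_i X i q * Mi i q).
  apply: (tangent_local Tv ak kp (openI oJ (openI oJ' oJ2))) => //; last first.
    by apply: smooth_funD => //; exact: smooth_fun_cst.
  move=> z [Jz [J'z J2z]] kz.
  have H y : J' y -> f (cbwd k y) = G (y - z0) by move=> J'y; rewrite /G subrK Eg.
  rewrite H// (hadamard _ sG) /G add0r Eg//= chartK//; congr (_ + _).
  apply: eq_bigr => i _; rewrite EX// /Mi psi1// mul1r cbwdK// !mxE.
  by congr (_ * radial_mean _ _ _); rewrite subrK.
rewrite EF (tangentD Tv)//; last exact: smooth_fun_cst.
rewrite (tangent_cst Tv) add0r vS.
rewrite derive_coords; last exact: smooth_fun_at sf.
apply: eq_bigr => i _; rewrite (tangentM Tv)// mxE.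
have -> : X i p = 0 by have := EX i _ Jp; rewrite chartK// subrr.
rewrite mul0r add0r mulrC; congr (_ * _).
have -> : Mi i p = m i 0 by rewrite /Mi subrr -{1}(chartK kp) psi1// mul1r.
rewrite /m /radial_mean (_ : (fun s => _) = fun=> 'D_(delta_mx 0 i) G 0); last first.
  by apply/funext => s; rewrite expr0 mul1r scaler0.
rewrite integral01_cst /G (derive_translate g z0 0) add0r; apply: near_eq_derive.
by apply: filterS (open_nbhs_nbhs (conj oJ' J'p)) => z J'z; rewrite Eg.
Qed.

End Tangent.

(** * Coordinate vector fields and Koszul's formula *)

Section Fields.
Context {R : realType} {M : Type} {n : nat} (A : manifold R M n).
Implicit Types (c d k : chart R M n) (p q : M) (f : M -> R) (a b : 'rV[R]_n).
Implicit Types X Y Z : M -> tvec R M.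

Lemma tangent_space_lin p (s : R) (v w : tvec R M) : tangent_space A p v -> tangent_space A p w ->
  tangent_space A p (s *: v + w).
Proof.
move=> [vl vm v0] [wl wm w0]; split=> [u f g sf sg|f g sf sg|f nf]; rewrite !fctE.
- by rewrite vl// wl// /GRing.scale /=; ring.
- by rewrite vm// wm// /GRing.scale /=; ring.
- by rewrite v0// w0// scaler0 addr0.
Qed.

Lemma tangent_space0 p : tangent_space A p 0.
Proof.
have E f : (0 : tvec R M) f = 0 by [].
split=> [u f g _ _|f g _ _|f _]; rewrite !E//; first by rewrite mulr0 addr0.
by rewrite !mulr0 addr0.
Qed.

Lemma tangent_spaceZ p (s : R) (v : tvec R M) : tangent_space A p v -> tangent_space A p (s *: v).
Proof. by move=> Tv; have := tangent_space_lin s Tv (tangent_space0 p); rewrite addr0. Qed.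

Lemma vfield_tangent X p : smooth_vfield A X -> tangent_space A p (X p).
Proof. by case=> + _; apply. Qed.

Lemma vfield_smooth X f : smooth_vfield A X -> smooth_fun A f -> smooth_fun A (fun q => X q f).
Proof. by case=> _; exact. Qed.

(** Global fields with constant coefficients near [p]; they serve as test fields
   in Koszul's formula. *)
Lemma coordinate_fields k p : adapted A k -> cdom k p ->
  exists (Y : 'rV[R]_n -> M -> tvec R M) (J : set 'rV[R]_n),
    [/\ open J, J (cfwd k p), J `<=` cimg k,
        forall a, smooth_vfield A (Y a) &
        forall a z, J z -> Y a (cbwd k z) = coordvec A k (cbwd k z) a].
Proof.
move=> ak kp; have oI := open_cimg (k:=k).
have [psi [[J [oJ Jp JO psi1]] psi0 psiS]] := cutoff ak kp oI (cimg_fwd kp) (@subset_refl _ _).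
exists (fun a q => psi q *: coordvec A k q a), J; split=> //; last first.
  by move=> a z Jz; rewrite psi1// scale1r.
move=> a; split=> [q _|f sf].
  have [->|/eqP/psi0[kq _]] := eqVneq (psi q) 0; first by rewrite scale0r; exact: tangent_space0.
  by apply: tangent_spaceZ; exact: coordvec_tangent.
have := psiS (fun q => 'D_a (f \o cbwd k : _ -> R^o) (cfwd k q)).
have -> : (fun q => (psi q *: coordvec A k q a) f) =
   (fun q => psi q * 'D_a (f \o cbwd k : _ -> R^o) (cfwd k q)).
  by apply/funext => q; rewrite -(coordvecE k q a sf).
apply; apply: (smooth_on_eq oI) (smooth_on_derive a (smooth_fun_chart ak sf)) => z kz.
by rewrite /= cbwdK.
Qed.

Lemma lie_bracket0 X Y p : (forall f, smooth_fun A f ->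
    X p (fun q => Y q f) = Y p (fun q => X q f)) -> lie_bracket A X Y p = 0.
Proof.
move=> h; apply/funext => f; rewrite /lie_bracket.
have [sf|nf] := pselect (smooth_fun A f); last by rewrite tnormalize_out.
by rewrite tnormalizeE// h// subrr.
Qed.

Lemma coordvec_near k p a f (g : 'rV[R]_n -> R^o) J : cdom k p -> smooth_fun A f ->
  open J -> J (cfwd k p) -> (forall z, J z -> f (cbwd k z) = g z) ->
  coordvec A k p a f = 'D_a g (cfwd k p).
Proof.
move=> kp sf oJ Jp fg; rewrite coordvecE//; apply: near_eq_derive.
by apply: filterS (open_nbhs_nbhs (conj oJ Jp)) => z Jz; exact: fg.
Qed.

(** Symmetry of second derivatives. *)
Lemma coordinate_bracket k p (Y : 'rV[R]_n -> M -> tvec R M) J a b :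
  adapted A k -> cdom k p -> open J -> J (cfwd k p) -> J `<=` cimg k ->
  (forall a, smooth_vfield A (Y a)) ->
  (forall a z, J z -> Y a (cbwd k z) = coordvec A k (cbwd k z) a) ->
  lie_bracket A (Y a) (Y b) p = 0.
Proof.
move=> ak kp oJ Jp JO sY EY; apply: lie_bracket0 => f sf.
have Ep a' : Y a' p = coordvec A k p a' by have := EY a' _ Jp; rewrite chartK.
have H a' b' : Y a' p (fun q => Y b' q f) = 'D_a' ('D_b' (f \o cbwd k : _ -> R^o)) (cfwd k p).
  rewrite Ep; apply: (coordvec_near _ kp (vfield_smooth (sY b') sf) oJ Jp) => z Jz.
  by rewrite EY// coordvecE// cbwdK//; exact: JO.
rewrite !H; apply: (schwarz _ _ (open_cimg (k:=k)) (smooth_fun_chart ak sf)).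
exact: cimg_fwd.
Qed.

Section LeviCivita.
Variables (G : M -> tvec R M -> tvec R M -> R)
  (nab : M -> tvec R M -> (M -> tvec R M) -> tvec R M).
Hypotheses (pG : pseudo_riemannian A G) (LC : levi_civita A G nab).

Lemma metricD (p : M) x y z : tangent_space A p x -> tangent_space A p y ->
  tangent_space A p z -> G p (x + y) z = G p x z + G p y z.
Proof.
by case: pG => + _ _ _ => Gl Tx Ty Tz; have := Gl p x y z 1 Tx Ty Tz; rewrite scale1r mul1r.
Qed.

Lemma metricC (p : M) x y : tangent_space A p x -> tangent_space A p y -> G p x y = G p y x.
Proof. by case: pG => _ + _ _; exact. Qed.

Lemma nab_tangent p v X : tangent_space A p v -> smooth_vfield A X -> tangent_space A p (nab p v X).
Proof. by case: LC => -[+ _ _ _ _] _ _; exact. Qed.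

(** Vanishing torsion exchanges the roles of two fields that commute at [p], at
   this point. *)
Lemma nab_commute X Y p : smooth_vfield A X -> smooth_vfield A Y ->
  lie_bracket A X Y p = 0 -> nab p (X p) Y = nab p (Y p) X.
Proof.
move=> sX sY b0; case: LC => _ + _ => /(_ X Y p sX sY); rewrite b0 => /eqP.
by rewrite subr_eq0 => /eqP.
Qed.

(** Koszul's formula, without its three bracket terms. *)
Lemma koszul_commuting X Y Z p : smooth_vfield A X -> smooth_vfield A Y -> smooth_vfield A Z ->
  lie_bracket A X Y p = 0 -> lie_bracket A X Z p = 0 -> lie_bracket A Y Z p = 0 ->
  2 * G p (nab p (X p) Y) (Z p) =
    X p (fun q => G q (Y q) (Z q)) + Y p (fun q => G q (X q) (Z q))
    - Z p (fun q => G q (X q) (Y q)).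
Proof.
move=> sX sY sZ bXY bXZ bYZ; case: LC => _ _ comp.
have T V := @vfield_tangent V p.
have TN V V' : smooth_vfield A V -> smooth_vfield A V' -> tangent_space A p (nab p (V p) V').
  by move=> sV sV'; apply: nab_tangent => //; exact: T.
rewrite (comp p (X p) Y Z)// ?(comp p (Y p) X Z)// ?(comp p (Z p) X Y)//; try exact: T.
rewrite (nab_commute sX sY bXY) (nab_commute sX sZ bXZ) (nab_commute sY sZ bYZ).
rewrite [G p (Y p) _]metricC; [ring|exact: T|exact: TN].
Qed.

End LeviCivita.
End Fields.

Section Gram.
Context {R : realType} {M : Type} {n : nat} (A : manifold R M n).
Variables (G : M -> tvec R M -> tvec R M -> R)
  (nab : M -> tvec R M -> (M -> tvec R M) -> tvec R M).
Hypotheses (pG : pseudo_riemannian A G) (LC : levi_civita A G nab).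
Variable k : chart R M n.
Hypothesis ak : adapted A k.

Definition gram (b c : 'rV[R]_n) (z : 'rV[R]_n) : R^o :=
  G (cbwd k z) (coordvec A k (cbwd k z) b) (coordvec A k (cbwd k z) c).

Lemma gramC z b c : cimg k z -> gram b c z = gram c b z.
Proof. by move=> /cdom_bwd kz; apply: (metricC pG); exact: coordvec_tangent. Qed.

Lemma gram_linear z c : cimg k z -> linear (fun b => gram b c z : R^o).
Proof.
move=> /cdom_bwd kz s b b'; rewrite /gram coordvec_linear//.
by case: pG => Gl _ _ _; apply: Gl; exact: coordvec_tangent.
Qed.

(** The first kind Christoffel symbols in terms of first derivatives of the Gram
   matrix. *)
Lemma koszul_coordinates p : cdom k p ->
  exists Y : 'rV[R]_n -> M -> tvec R M, exists J : set 'rV[R]_n,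
   [/\ [/\ open J, J (cfwd k p), J `<=` cimg k, forall a, smooth_vfield A (Y a) &
        forall a z, J z -> Y a (cbwd k z) = coordvec A k (cbwd k z) a],
    forall b c, differentiable (gram b c) (cfwd k p) &
    forall a b c, 2 * G p (nab p (coordvec A k p a) (Y b)) (coordvec A k p c) =
      'D_a (gram b c) (cfwd k p) + 'D_b (gram a c) (cfwd k p) - 'D_c (gram a b) (cfwd k p)].
Proof.
move=> kp; have [Y [J [oJ Jp JO sY EY]]] := coordinate_fields ak kp.
exists Y, J.
have Ep a : coordvec A k p a = Y a p by have := EY a _ Jp; rewrite chartK.
have bra a b := coordinate_bracket a b ak kp oJ Jp JO sY EY.
have sG b c : smooth_fun A (fun q => G q (Y b q) (Y c q)).
  case: pG => _ _ _; apply => // q; split; exact: vfield_tangent.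
have EG b c z : J z -> G (cbwd k z) (Y b (cbwd k z)) (Y c (cbwd k z)) = gram b c z.
  by move=> Jz; rewrite /gram !EY.
split; first by [].
- move=> b c; apply: near_eq_differentiable (smooth_fun_at ak kp (sG b c)).
  by apply: filterS (open_nbhs_nbhs (conj oJ Jp)) => z Jz; exact: EG.
- move=> a b c; rewrite !Ep (koszul_commuting pG LC)//.
  by rewrite -!Ep !(coordvec_near _ kp (sG _ _) oJ Jp (EG _ _)).
Qed.

Lemma velocity_coordvec (e : R -> M) (t : R) (J : set R^o) : open J -> J t ->
  (forall s, J s -> cdom k (e s)) -> differentiable (cfwd k \o e : R^o -> _) t ->
  velocity A e t = coordvec A k (e t) ('D_(1 : R^o) (cfwd k \o e : R^o -> _) t).
Proof.
move=> oJ Jt Jk de; apply: tnormalize_eq => f sf.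
have ke := Jk _ Jt.
rewrite derive1E -(@derive_comp _ _ _ _ (cfwd k \o e : R^o -> _) (f \o cbwd k : _ -> R^o))//.
  apply: near_eq_derive; apply: filterS (open_nbhs_nbhs (conj oJ Jt)) => s Js.
  by rewrite /= chartK//; exact: Jk.
exact: smooth_fun_at ak ke sf.
Qed.

End Gram.

(** * Vector bundles in a trivializing chart *)

Lemma smooth_into_chart (R : realType) (M : Type) (n : nat) (A : manifold R M n)
    (V : normedModType R) (U : set V) (f : V -> M) k x :
  adapted A k -> smooth_into A U f -> U x -> cdom k (f x) ->
  exists J, [/\ open J, J x, forall y, J y -> cdom k (f y) & smooth_on J (cfwd k \o f)].
Proof.
move=> ak sf Ux kx; have [d Ad dx] := atlas_chart_at A (f x).
have [J [oJ Jx Jd sJ]] := sf x d Ux Ad dx.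
have [oO sO] := (ak d Ad).2; set O := cfwd d @` _ in oO sO.
have oJ' : open (J `&` (cfwd d \o f) @^-1` O).
  apply: open_preimage_within => // y Jy.
  by apply: differentiable_continuous; exact: smooth_on_differentiable sJ Jy.
have Jdom y : J y -> cdom d (f y) by move=> Jy; apply: Jd; exists y.
exists (J `&` (cfwd d \o f) @^-1` O); split=> //.
- by split=> //; exists (f x).
- by move=> y [Jy /cimg_subP[_]]; rewrite /= chartK//; exact: Jdom.
- have := smooth_compv oJ' oO (smooth_on_sub (@subIsetl _ J _) sJ) sO (fun y (h : (J `&` _) y) => h.2).
  apply: (smooth_on_eq oJ') => y [Jy _].
  by rewrite /= chartK//; exact: Jdom.
Qed.

Section Bundle.
Context {R : realType} {M : Type} {n r : nat} {F : M -> lmodType R}.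
Context (A : manifold R M n) (B : manifold R (totsp F) (n + r)).

(** A trivialization [Phi] over [U], a chart [c] of the base, and the chart [k]
   of the total space that they induce: base coordinates first, fiber
   coordinates last. *)
Record bundle_chart (c : chart R M n) (U : set M) (Phi : forall q, F q -> 'rV[R]_r)
    (k : chart R (totsp F) (n + r)) : Prop := BundleChart {
  bc_atlas : atlas A c;
  bc_open : mopen A U;
  bc_linear : forall q, U q -> linear (Phi q);
  bc_bij : forall q, U q -> bijective (Phi q);
  bc_dom : cdom k = bproj (F := F) @^-1` (cdom c `&` U);
  bc_fwd : forall q (x : F q), (cdom c `&` U) q ->
    cfwd k (bpt x) = row_mx (cfwd c q) (Phi q x);
  bc_adapted : adapted B k }.

Lemma bundle_chart_at (e : totsp F) : vector_bundle A B ->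
  exists c U Phi k, bundle_chart c U Phi k /\ cdom k e.
Proof.
move=> vb; have [c Ac ce] := atlas_chart_at A (bproj e).
have [U [Phi [oU Ue PhiP /(_ c Ac)[k [kd kf kc]]]]] := vb (bproj e).
exists c, U, Phi, k; split; last by rewrite kd.
by split=> // q /PhiP[].
Qed.

Section Chart.
Variables (c : chart R M n) (U : set M) (Phi : forall q, F q -> 'rV[R]_r)
  (k : chart R (totsp F) (n + r)).
Hypothesis bc : bundle_chart c U Phi k.

Let V := cdom c `&` U.

Definition bc_base : set 'rV[R]_n := cfwd c @` V.

Lemma bc_domP e : cdom k e <-> V (bproj e). Proof. by rewrite (bc_dom bc). Qed.

Lemma bc_adaptedc : adapted A c.
Proof. exact: atlas_adapted (bc_atlas bc). Qed.

(** The image of [k] is a product of an open set with the whole fiber space, so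
   that vertical lines never leave it. *)
Lemma bc_cimgP z : cimg k z <-> bc_base (lsubmx z).
Proof.
split=> [[[q x] /bc_domP Vq <-]|[q Vq Eq]].
  by rewrite (bc_fwd bc (q := q) x Vq) row_mxKl; exists q.
have [g gK Kg] := bc_bij bc Vq.2.
exists (bpt (g (rsubmx z))); first exact/bc_domP.
by rewrite (bc_fwd bc)// Kg Eq hsubmxK.
Qed.

Lemma bc_bproj z : cimg k z -> bproj (cbwd k z) = cbwd c (lsubmx z).
Proof.
move=> [[q x] kq <-]; rewrite chartK//; have /bc_domP Vq := kq.
by rewrite (bc_fwd bc (q := q) x Vq) row_mxKl chartK//; case: Vq.
Qed.

Lemma bc_lsub_fwd e : cdom k e -> lsubmx (cfwd k e) = cfwd c (bproj e).
Proof.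
case: e => q x /bc_domP Vq.
by rewrite (bc_fwd bc (q := q) x Vq) row_mxKl.
Qed.

(** Fiberwise linearity of the trivialization turns the straight lines of the
   fibers into vertical straight lines of the chart. *)
Lemma fiber_vec_coordvec q (x w : F q) : V q ->
  fiber_vec B x w = coordvec B k (bpt x) (row_mx 0 (Phi w)).
Proof.
move=> Vq; rewrite /fiber_vec /fiber_velocity /velocity /coordvec.
apply: tnormalize_eq => f _; rewrite derive1E [RHS]derive_line.
have E : (f \o (fun u : R => bpt (x + u *: w))) =
    (fun t : R^o => (f \o cbwd k) (cfwd k (bpt x) + t *: row_mx 0 (Phi w))) :> (R^o -> R^o).
  apply/funext => u /=; congr f; have kx : cdom k (bpt (x + u *: w)) by exact/bc_domP.
  rewrite -[LHS](chartK kx) !(bc_fwd bc)//; congr (cbwd k _).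
  rewrite scale_row_mx scaler0 add_row_mx addr0; congr row_mx.
  by rewrite addrC (bc_linear bc Vq.2) addrC.
exact: (congr1 (fun g : R^o -> R^o => 'D_1 g 0) E).
Qed.

Lemma bproj_smooth_chart phi : smooth_fun A phi ->
  smooth_on (cimg k) ((phi \o bproj (F := F)) \o cbwd k : _ -> R^o).
Proof.
move=> sphi; have oI := open_cimg (k := k).
have s1 : smooth_on (cimg k) (fun z : 'rV[R]_(n + r) => lsubmx z).
  apply/(smooth_rowP _ oI) => i; apply: (smooth_on_eq oI) (@smooth_coord R _ _ (lshift r i)) => z _.
  by rewrite mxE.
have sO := smooth_on_sub _ (smooth_fun_chart bc_adaptedc sphi).
have H z : cimg k z -> cimg c (lsubmx z) by move=> /bc_cimgP[q [cq _] <-]; exact: cimg_fwd.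
apply: (smooth_on_eq oI) (smooth_comp oI s1 (smooth_fun_chart bc_adaptedc sphi) H) => z kz.
by rewrite /= bc_bproj.
Qed.

Lemma derive_vertical (g : 'rV[R]_(n + r) -> R^o) z (eta : 'rV[R]_r) : differentiable g z ->
  'D_(row_mx 0 eta) g z = \sum_j eta 0 j * 'D_(delta_mx 0 (rshift n j)) g z.
Proof.
move=> dg; rewrite derive_coords// big_split_ord /= big1 ?add0r; last first.
  by move=> i _; rewrite row_mxEl mxE mul0r.
by apply: eq_bigr => j _; rewrite row_mxEr.
Qed.

Variable w : forall q, F q.
Hypothesis sw : smooth_section A B w.

Definition section_coord (x : 'rV[R]_n) : 'rV[R]_r := Phi (w (cbwd c x)).

Lemma section_coord_smooth j : smooth_on bc_base (fun x => section_coord x 0 j : R^o).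
Proof.
apply: smooth_on_loc => x Ox; have [q Vq Eq] := Ox.
have cx : cimg c x by rewrite -Eq; apply: cimg_fwd; case: Vq.
have Vx : V (cbwd c x) by rewrite -Eq chartK//; case: Vq.
have kx : cdom k (bpt (w (cbwd c x))) by exact/bc_domP.
have [J [oJ Jx Jk sJ]] := smooth_into_chart (bc_adapted bc) (sw (bc_atlas bc)) cx kx.
exists J => //; have sJj := (smooth_rowP _ oJ).1 sJ (rshift n j).
apply: (smooth_on_eq oJ) sJj => y /Jk/bc_domP Vy.
by rewrite /= (bc_fwd bc)// row_mxEr.
Qed.

Lemma translation_field_coordvec e : cdom k e ->
  translation_field B w e = coordvec B k e (row_mx 0 (section_coord (lsubmx (cfwd k e)))).
Proof.
move=> ke; rewrite bc_lsub_fwd//; case: e ke => q x /bc_domP Vq.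
rewrite /translation_field (fiber_vec_coordvec x (w q) Vq) /section_coord /=.
by rewrite chartK//; case: Vq.
Qed.

Lemma translation_field_smooth_chart f : smooth_fun B f ->
  smooth_on (cimg k) ((fun e => translation_field B w e f) \o cbwd k : _ -> R^o).
Proof.
move=> sf; have oI := open_cimg (k := k).
have sF := smooth_fun_chart (bc_adapted bc) sf.
have s1 : smooth_on (cimg k) (fun z : 'rV[R]_(n + r) => lsubmx z).
  apply/(smooth_rowP _ oI) => i; apply: (smooth_on_eq oI) (@smooth_coord R _ _ (lshift r i)) => z _.
  by rewrite mxE.
have sj j : smooth_on (cimg k) (fun z => section_coord (lsubmx z) 0 j *
    'D_(delta_mx 0 (rshift n j)) (f \o cbwd k : _ -> R^o) z : R^o).
  apply: (smoothM oI); last exact: smooth_on_derive.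
  by apply: (smooth_comp oI s1 (section_coord_smooth j)) => z /bc_cimgP.
apply: (smooth_on_eq oI) (smooth_sum oI sj) => z kz.
rewrite /= translation_field_coordvec; last exact: cdom_bwd.
rewrite coordvecE// cbwdK// derive_vertical//.
exact: smooth_on_differentiable sF kz.
Qed.

(** The coefficients of a translation-invariant field are constant along
   vertical lines, so along such a line it acts as a constant coefficient field
   and second derivatives commute. The bracket with horizontal coordinate fields
   need not vanish. *)
Lemma translation_field_bracket e (Y : 'rV[R]_(n + r) -> totsp F -> tvec R (totsp F)) J alpha :
  cdom k e -> open J -> J (cfwd k e) -> J `<=` cimg k ->
  (forall a, smooth_vfield B (Y a)) ->
  (forall a z, J z -> Y a (cbwd k z) = coordvec B k (cbwd k z) a) ->
  smooth_vfield B (translation_field B w) ->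
  lie_bracket B (Y (row_mx 0 alpha)) (translation_field B w) e = 0.
Proof.
move=> ke oJ Jp JO sY EY sW; apply: lie_bracket0 => f sf.
have oI := open_cimg (k := k).
have sF := smooth_fun_chart (bc_adapted bc) sf.
set a := row_mx 0 alpha; set z0 := cfwd k e.
pose b : 'rV[R]_(n + r) := row_mx 0 (section_coord (lsubmx z0)).
have -> : Y a e = coordvec B k e a by have := EY a _ Jp; rewrite chartK.
rewrite translation_field_coordvec// -/z0 -/b.
rewrite (coordvec_near (k := k) b ke (vfield_smooth (sY a) sf) oJ Jp
  (g := 'D_a (f \o cbwd k : _ -> R^o))); last first.
  by move=> z Jz; rewrite EY// coordvecE// cbwdK//; exact: JO.
rewrite (coordvec_near (k := k) a ke (vfield_smooth sW sf) oI (cimg_fwd ke)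
  (g := fun z => 'D_(row_mx 0 (section_coord (lsubmx z))) (f \o cbwd k : _ -> R^o) z)); last first.
  move=> z kz; rewrite translation_field_coordvec; last exact: cdom_bwd.
  by rewrite coordvecE// cbwdK.
rewrite [RHS](schwarz b a oI sF (cimg_fwd ke)).
rewrite [LHS]derive_line [RHS]derive_line.
have E : (fun t : R^o => 'D_(row_mx 0 (section_coord (lsubmx (z0 + t *: a)))) (f \o cbwd k : _ -> R^o) (z0 + t *: a))
  = (fun t : R^o => 'D_b (f \o cbwd k : _ -> R^o) (z0 + t *: a)).
  apply/funext => t; congr (derive _ _ (row_mx 0 (section_coord _))).
  by rewrite linearD linearZ /= row_mxKl scaler0 addr0.
exact: (congr1 (fun g : R^o -> R^o => 'D_1 g 0) E).
Qed.

End Chart.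

Hypothesis vb : vector_bundle A B.

Lemma bproj_smooth phi : smooth_fun A phi -> smooth_fun B (phi \o bproj (F := F)).
Proof.
move=> sphi; apply: smooth_at_fun => e; have [c [U [Phi [k [bc ke]]]]] := bundle_chart_at e vb.
exists k, (cimg k); split=> //; [exact: bc_adapted bc|exact: open_cimg|exact: cimg_fwd|].
exact: bproj_smooth_chart bc _ sphi.
Qed.

Lemma translation_field_smooth w : smooth_section A B w ->
  smooth_vfield B (translation_field B w).
Proof.
move=> sw; split=> [e _|f sf].
  have [c [U [Phi [k [bc ke]]]]] := bundle_chart_at e vb.
  rewrite (translation_field_coordvec bc w ke).
  by apply: coordvec_tangent => //; exact: bc_adapted bc.
apply: smooth_at_fun => e; have [c [U [Phi [k [bc ke]]]]] := bundle_chart_at e vb.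
exists k, (cimg k); split=> //; [exact: bc_adapted bc|exact: open_cimg|exact: cimg_fwd|].
exact: translation_field_smooth_chart bc _ sw _ sf.
Qed.

Section Vertical.
Variables (c : chart R M n) (U : set M) (Phi : forall q, F q -> 'rV[R]_r)
  (k : chart R (totsp F) (n + r)).
Hypothesis bc : bundle_chart c U Phi k.

Lemma dproj_coordvec e a : cdom k e ->
  dproj A (coordvec B k e a) = coordvec A c (bproj e) (lsubmx a).
Proof.
move=> ke; apply: tnormalize_eq => phi sphi.
have oI := open_cimg (k := k).
rewrite (coordvec_near a ke (bproj_smooth sphi) oI (cimg_fwd ke)
  (g := (phi \o cbwd c : _ -> R^o) \o lsubmx)); last first.
  by move=> z kz; rewrite /= (bc_bproj bc).
have ce : cdom c (bproj e) by have /(bc_domP bc)[] := ke.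
rewrite (@derive_comp _ _ _ _ lsubmx (phi \o cbwd c : _ -> R^o)).
- rewrite (bc_lsub_fwd bc ke); congr ('D_ _ _ _).
  rewrite deriveE; last exact: differentiable_lsubmx.
  by rewrite diff_lin//; exact: continuous_lsubmx.
- exact: differentiable_lsubmx.
- by rewrite (bc_lsub_fwd bc ke); apply: smooth_fun_at ce sphi; exact: bc_adaptedc bc.
Qed.

(** A vertical vector kills the functions lifted from the base; among them are
   the (cut off) base coordinates, hence its first [n] components vanish. *)
Lemma verticalP e v : cdom k e ->
  vertical A B e v <-> exists eta, v = coordvec B k e (row_mx 0 eta).
Proof.
move=> ke; have ce : cdom c (bproj e) by have /(bc_domP bc)[] := ke.
have ac := bc_adaptedc bc; have ak := bc_adapted bc.
split=> [[Tv]|[eta ->]].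
  have [a ->] := tangent_coordvec ak ke Tv.
  rewrite dproj_coordvec// => /(coordvec_inj ac ce) a0.
  by exists (rsubmx a); rewrite -{1}(hsubmxK a) a0.
split; first exact: coordvec_tangent.
by rewrite dproj_coordvec// row_mxKl coordvec0.
Qed.

End Vertical.
End Bundle.

(** * Vertical derivatives of translation-invariant fields *)

Section Metric.
Context {R : realType} {M : Type} {n r : nat} {F : M -> lmodType R}.
Context (A : manifold R M n) (B : manifold R (totsp F) (n + r)).
Variables (D : totsp F -> set (tvec R (totsp F)))
    (h : totsp F -> tvec R (totsp F) -> tvec R (totsp F) -> R)
    (g : M -> tvec R M -> tvec R M -> R)
    (G : totsp F -> tvec R (totsp F) -> tvec R (totsp F) -> R)
    (nab : totsp F -> tvec R (totsp F) -> (totsp F -> tvec R (totsp F)) ->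
             tvec R (totsp F)).
Hypotheses (vb : vector_bundle A B) (hD : horizontal_distribution A B D)
  (ti : translation_invariant_metric A B h) (tG : total_metric A B g h D G)
  (LC : levi_civita B G nab).

Let pG : pseudo_riemannian B G. Proof. by case: tG. Qed.

Lemma horizontal_tangent e v : D e v -> tangent_space B e v.
Proof.
move=> Dv; have [_ /(_ e)[DV ->]] := hD; exists v, 0; split=> //; last by rewrite addr0.
have : [set (0 : tvec R (totsp F))] 0 by [].
by rewrite -DV => -[].
Qed.

(** Translation of a fiber by x' - x maps straight lines to straight lines with
   the same direction. *)
Lemma fiber_metric_translation p (x x' w1 w2 : F p) :
  h (bpt x) (fiber_vec B x w1) (fiber_vec B x w2) =
  h (bpt x') (fiber_vec B x' w1) (fiber_vec B x' w2).
Proof.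
have [_ /(_ p (x' - x))[_ iso]] := ti.
have E w : fiber_velocity B (fun y => y + (x' - x)) x w = fiber_vec B x' w.
  rewrite /fiber_vec /fiber_velocity; congr velocity; apply/funext => u.
  by rewrite /= addrAC subrKC.
by have := iso x w1 w2; rewrite !E subrKC => ->.
Qed.

Lemma total_metric_vertical e x y : vertical A B e x -> vertical A B e y -> G e x y = h e x y.
Proof. by case: tG => _ /(_ e)[_ + _]; exact. Qed.

Lemma total_metric_orth e x y : D e x -> vertical A B e y -> G e x y = 0.
Proof. by case: tG => _ /(_ e)[+ _ _]; exact. Qed.

(** Split a vector into horizontal and vertical parts: the vertical part is
   orthogonal to the fibers, hence zero because the fiber metric is
   nondegenerate. *)
Lemma orthogonal_horizontal e z : tangent_space B e z ->
  (forall u, vertical A B e u -> G e z u = 0) -> D e z.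
Proof.
move=> Tz zV; have [_ /(_ e)[_ TE]] := hD.
move: (Tz); rewrite TE => -[x [y [Dx Vy E]]].
suff y0 : y = 0 by rewrite E y0 addr0.
have [[_ _ nd _] _] := ti; apply: (nd e) => // u Vu.
rewrite -total_metric_vertical//.
have := zV u Vu; rewrite E (metricD pG (horizontal_tangent Dx) Vy.1 Vu.1).
by rewrite total_metric_orth// add0r.
Qed.

Section Chart.
Variables (c : chart R M n) (U : set M) (Phi : forall q, F q -> 'rV[R]_r)
  (k : chart R (totsp F) (n + r)).
Hypothesis bc : bundle_chart A B c U Phi k.

Let V := cdom c `&` U.
Let ak := bc_adapted bc.

Notation vgram z alpha beta := (gram B G k (row_mx 0 alpha) (row_mx 0 beta) z).

Lemma vertical_coordvec e eta : cdom k e -> vertical A B e (coordvec B k e (row_mx 0 eta)).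
Proof. by move=> ke; apply/(verticalP vb bc _ ke); exists eta. Qed.

Lemma vgram_h q (x w1 w2 : F q) : V q ->
  vgram (cfwd k (bpt x)) (Phi w1) (Phi w2) = h (bpt x) (fiber_vec B x w1) (fiber_vec B x w2).
Proof.
move=> Vq; have kx : cdom k (bpt x) by exact/(bc_domP bc).
rewrite /gram chartK// total_metric_vertical; try exact: vertical_coordvec.
by rewrite !(fiber_vec_coordvec bc).
Qed.

(** Translation invariance, read in the chart: two points of the chart with the
   same base coordinates lie in one fiber. *)
Lemma vgram_fiber z z' alpha beta : cimg k z -> lsubmx z = lsubmx z' ->
  vgram z alpha beta = vgram z' alpha beta.
Proof.
move=> kz E; have kz' : cimg k z' by apply/(bc_cimgP bc); rewrite -E; apply/(bc_cimgP bc).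
have [p [kp Ez]] : exists p, cdom k p /\ cfwd k p = z by case: kz => p; exists p.
have [p' [kp' Ez']] : exists p, cdom k p /\ cfwd k p = z' by case: kz' => p'; exists p'.
have Vp := (bc_domP bc p).1 kp; have Vp' := (bc_domP bc p').1 kp'.
have Eb : bproj p = bproj p'.
  rewrite -(chartK Vp.1) -(chartK Vp'.1) -!(bc_lsub_fwd bc)//; congr (cbwd c _).
  by rewrite Ez Ez'.
rewrite -Ez -Ez'; case: p p' Eb {kp kp' Ez Ez' Vp'} Vp => q x [q' x'] /= Eb.
case: q' / Eb x' => x' Vq.
have [i iK Ki] := bc_bij bc Vq.2.
rewrite -(Ki alpha) -(Ki beta) !vgram_h//; exact: fiber_metric_translation.
Qed.

Lemma derive_vgram_vertical z a alpha beta : cimg k z ->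
  'D_(row_mx 0 a) (gram B G k (row_mx 0 alpha) (row_mx 0 beta)) z = 0.
Proof.
move=> kz; rewrite derive_line.
have E : (fun t : R^o => vgram (z + t *: row_mx 0 a) alpha beta) = cst (vgram z alpha beta).
  apply/funext => t; apply/esym; apply: vgram_fiber => //.
  by rewrite linearD linearZ /= row_mxKl scaler0 addr0.
by rewrite E derive_cst.
Qed.

Section AtPoint.
Variables (e : totsp F) (Y : 'rV[R]_(n + r) -> totsp F -> tvec R (totsp F)).
Hypotheses (ke : cdom k e) (sY : forall a, smooth_vfield B (Y a))
  (kos : forall a b c, 2 * G e (nab e (coordvec B k e a) (Y b)) (coordvec B k e c) =
      'D_a (gram B G k b c) (cfwd k e) + 'D_b (gram B G k a c) (cfwd k e)
      - 'D_c (gram B G k a b) (cfwd k e)).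

(** All three terms of Koszul's formula are vertical derivatives of functions
   that are constant along the fiber. *)
Lemma nab_vertical_orth alpha beta u : vertical A B e u ->
  G e (nab e (coordvec B k e (row_mx 0 alpha)) (Y (row_mx 0 beta))) u = 0.
Proof.
move=> /(verticalP vb bc _ ke)[eta ->].
have := kos (row_mx 0 alpha) (row_mx 0 beta) (row_mx 0 eta).
have kz := cimg_fwd ke.
rewrite !derive_vgram_vertical// addr0 subr0 => /eqP.
by rewrite mulf_eq0 pnatr_eq0 /= => /eqP.
Qed.

Lemma nab_vertical_horizontal alpha beta :
  D e (nab e (coordvec B k e (row_mx 0 alpha)) (Y (row_mx 0 beta))).
Proof.
apply: orthogonal_horizontal => [|u]; last exact: nab_vertical_orth.
by apply: (nab_tangent LC) => //; exact: coordvec_tangent.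
Qed.

End AtPoint.

(** Only the value of the section at the base point matters. The field W =
   [translation_field B w] commutes at [e] with the vertical coordinate field V
   = [Y (row_mx 0 alpha)], so the derivative of W along V is that of V along W;
   the latter depends only on the value of W at [e], which is also the value of
   a coordinate field, and the same exchange applies backwards. *)
Lemma nab_translation_field e (Y : 'rV[R]_(n + r) -> totsp F -> tvec R (totsp F)) J w alpha :
  cdom k e -> open J -> J (cfwd k e) -> J `<=` cimg k ->
  (forall a, smooth_vfield B (Y a)) ->
  (forall a z, J z -> Y a (cbwd k z) = coordvec B k (cbwd k z) a) ->
  smooth_section A B w -> exists beta,
  nab e (coordvec B k e (row_mx 0 alpha)) (translation_field B w) =
  nab e (coordvec B k e (row_mx 0 alpha)) (Y (row_mx 0 beta)).
Proof.
move=> ke oJ Jp JO sY EY sw; have sW := translation_field_smooth vb sw.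
exists (section_coord c Phi w (lsubmx (cfwd k e))).
have Ep a : coordvec B k e a = Y a e by have := EY a _ Jp; rewrite chartK.
have b1 := translation_field_bracket bc alpha ke oJ Jp JO sY EY sW.
rewrite !Ep (nab_commute LC (sY _) sW b1).
rewrite (translation_field_coordvec bc w ke) Ep.
apply: (nab_commute LC) => //; exact: coordinate_bracket oJ Jp JO sY EY.
Qed.

End Chart.
End Metric.

(** * Parallel transport of a metric connection *)

Section Transport.
Context {R : realType} {M : Type} {n r : nat} {F : M -> lmodType R}.
Context (A : manifold R M n) (B : manifold R (totsp F) (n + r)).
Variables (D : totsp F -> set (tvec R (totsp F)))
    (h : totsp F -> tvec R (totsp F) -> tvec R (totsp F) -> R).

(** Every map assembled pointwise from endpoints of horizontal lifts is a
   parallel transport, hence bijective for a metric connection; this takes the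
   place of the uniqueness theorem for differential equations. If two transports
   differed at [x], redirecting the first one at [x] to the other endpoint would
   destroy injectivity, as the first one already attains that endpoint
   elsewhere. *)
Lemma transport_unique (cv : R -> M) (a b : R) (P P' : F (cv a) -> F (cv b)) :
  metric_connection A B D h -> a < b -> smooth_curve A a b cv ->
  parallel_transport B D P -> parallel_transport B D P' -> P = P'.
Proof.
move=> met ab scv pP pP'; apply/funext => x; apply: contrapT => ne.
pose P2 y := if pselect (y = x) then P' x else P y.
have P2x : P2 x = P' x by rewrite /P2; case: pselect.
have P2n y : y <> x -> P2 y = P y by rewrite /P2; case: pselect.
have pP2 : parallel_transport B D P2.
  move=> y; have [->|/P2n ->] := pselect (y = x); last exact: pP.
  by rewrite P2x; exact: pP'.
have [[g gK Kg] _] := met _ _ _ _ ab scv pP.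
have [/bij_inj i2 _] := met _ _ _ _ ab scv pP2.
have yx : g (P' x) <> x by move=> E; apply: ne; rewrite -[RHS]Kg E.
by apply: (yx); apply: i2; rewrite (P2n _ yx) Kg P2x.
Qed.

(** For a linear transport the curves in the definition of a fiber isometry are
   straight lines of the target fiber. *)
Lemma transport_isometry (cv : R -> M) (a b : R) (P : F (cv a) -> F (cv b)) x w1 w2 :
  metric_connection A B D h -> a < b -> smooth_curve A a b cv ->
  parallel_transport B D P -> linear P ->
  h (bpt (P x)) (fiber_vec B (P x) (P w1)) (fiber_vec B (P x) (P w2)) =
  h (bpt x) (fiber_vec B x w1) (fiber_vec B x w2).
Proof.
move=> met ab scv pP lP; have [_ iso] := met _ _ _ _ ab scv pP.
have E w : fiber_velocity B P x w = fiber_vec B (P x) (P w).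
  rewrite /fiber_vec /fiber_velocity; congr velocity; apply/funext => u.
  by rewrite /= addrC lP addrC.
by have := iso x w1 w2; rewrite !E.
Qed.

Lemma horizontal_lift_sub (cv : R -> M) (a b b' : R) (s : forall t, F (cv t)) : b' <= b ->
  horizontal_lift B D a b s -> horizontal_lift B D a b' s.
Proof.
move=> bb [[I [oI Ib sI]] Ds]; split.
  by exists I; split=> // t /andP[ta tb]; apply: Ib; rewrite ta (le_trans tb).
by move=> t /andP[ta tb]; apply: Ds; rewrite ta (le_trans tb).
Qed.

(** The base curves along which transport is used: straight lines in a chart, on
   an interval that stays in the trivialized part. *)
Lemma coordinate_line (c : chart R M n) (U : set M) x0 xi : atlas A c -> mopen A U ->
  (cfwd c @` (cdom c `&` U)) x0 -> exists (I : set R^o) (tau : R),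
  [/\ open I, 0 < tau, forall t : R, 0 <= t <= tau -> I t,
      forall t, I t -> (cfwd c @` (cdom c `&` U)) (x0 + t *: xi) &
      forall b : R, b <= tau -> smooth_curve A 0 b (fun t => cbwd c (x0 + t *: xi))].
Proof.
move=> Ac oU Ox0; have oO := oU c Ac; set O := cfwd c @` _ in oO Ox0 *.
pose l (t : R^o) := x0 + t *: xi.
have sl (I : set R^o) : open I -> smooth_on I l by exact: smooth_line.
have cl t : {for t, continuous l}.
  by apply: differentiable_continuous; exact: smooth_on_differentiable (sl setT openT) I.
have oI : open (setT `&` l @^-1` O) by apply: open_preimage_within => //; exact: openT.
set I := _ `&` _ in oI.
have I0 : I 0 by split=> //; rewrite /l /= scale0r addr0.
have /nbhs_normP[d /= d0 hd] := open_nbhs_nbhs (conj oI I0).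
have dI (t : R) : 0 <= t <= d / 2 -> I t.
  move=> /andP[t0 td]; apply: hd; rewrite /= sub0r normrN ger0_norm//.
  by move: d0 td; lra.
exists I, (d / 2); split=> //; first by rewrite divr_gt0.
  by move=> t [].
move=> b bd; exists I; split=> //.
  by move=> t /andP[t0 tb]; apply: dI; rewrite t0 (le_trans tb).
move=> t e It Ae et.
have [oT sT] := atlas_compat Ac Ae; set O' := cfwd c @` _ in oT sT.
have oJ : open (I `&` l @^-1` O') by exact: open_preimage_within.
have cimgl t' : I t' -> cimg c (l t') by move=> [_ [q [cq _] <-]]; exact: cimg_fwd.
exists (I `&` l @^-1` O'); split=> //.
- by split=> //; apply/cimg_subP; split=> //; exact: cimgl.
- by move=> _ [t' [It' /cimg_subP[_ ?]] <-].
- exact: (smooth_compv oJ oT (sl _ oJ) sT (fun y (hy : (I `&` _) y) => hy.2)).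
Qed.

End Transport.

Section Metric.
Context {R : realType} {M : Type} {n r : nat} {F : M -> lmodType R}.
Context (A : manifold R M n) (B : manifold R (totsp F) (n + r)).
Variables (D : totsp F -> set (tvec R (totsp F)))
    (h : totsp F -> tvec R (totsp F) -> tvec R (totsp F) -> R)
    (g : M -> tvec R M -> tvec R M -> R)
    (G : totsp F -> tvec R (totsp F) -> tvec R (totsp F) -> R).
Hypotheses (vb : vector_bundle A B) (bD : bundle_connection A B D)
  (ti : translation_invariant_metric A B h) (tG : total_metric A B g h D G)
  (met : metric_connection A B D h).

Let pG : pseudo_riemannian B G. Proof. by case: tG. Qed.

Variables (c : chart R M n) (U : set M) (Phi : forall q, F q -> 'rV[R]_r)
  (k : chart R (totsp F) (n + r)).
Hypothesis bc : bundle_chart A B c U Phi k.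

Let V := cdom c `&` U.
Let ak := bc_adapted bc.

Notation vgram z alpha beta := (gram B G k (row_mx 0 alpha) (row_mx 0 beta) z).

Lemma row_mx0_linear : linear (fun a : 'rV[R]_r => row_mx (0 : 'rV[R]_n) a).
Proof. by move=> s a b; rewrite scale_row_mx add_row_mx scaler0 addr0. Qed.

Lemma vgram_linear z beta : cimg k z -> linear (fun a => vgram z a beta : R^o).
Proof. by move=> kz s a b; rewrite row_mx0_linear (gram_linear pG ak _ kz). Qed.

Lemma vgramC z a b : cimg k z -> vgram z a b = vgram z b a.
Proof. exact: (gramC pG ak). Qed.

(** The product rule for the fiber metric along a curve reduces to scalar
   functions through this expansion. *)
Lemma vgram_expand z a b : cimg k z ->
  vgram z a b = \sum_i \sum_j a 0 i * (b 0 j * vgram z (delta_mx 0 i) (delta_mx 0 j)).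
Proof.
move=> kz; rewrite (linear_row_expand a (vgram_linear b kz)); apply: eq_bigr => i _.
rewrite vgramC// (linear_row_expand b (vgram_linear _ kz)) mulr_sumr.
by apply: eq_bigr => j _; rewrite vgramC.
Qed.

Lemma derive_vgram_along z v (u1 u2 : R^o -> 'rV[R]_r) (I : set R^o) : open I -> I 0 ->
  (forall t, I t -> cimg k (z + t *: v)) ->
  (forall a b, differentiable (gram B G k a b) z) ->
  differentiable u1 0 -> differentiable u2 0 ->
  is_derive (0 : R^o) (1 : R^o) (fun t => vgram (z + t *: v) (u1 t) (u2 t))
   ('D_v (gram B G k (row_mx 0 (u1 0)) (row_mx 0 (u2 0))) z
    + vgram z ('D_1 u1 0) (u2 0) + vgram z (u1 0) ('D_1 u2 0)).
Proof.
move=> oI I0 kI dG d1 d2.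
have kz : cimg k z by have := kI 0 I0; rewrite scale0r addr0.
pose m i j (t : R^o) : R^o := vgram (z + t *: v) (delta_mx 0 i) (delta_mx 0 j).
pose dm i j := 'D_v (gram B G k (row_mx 0 (delta_mx 0 i)) (row_mx 0 (delta_mx 0 j))) z.
have hm i j : is_derive (0 : R^o) (1 : R^o) (m i j) (dm i j).
  have := @derive_along_line R _ R^o (gram B G k (row_mx 0 (delta_mx 0 i)) (row_mx 0 (delta_mx 0 j))) z v 0.
  by rewrite scale0r addr0; apply; exact: dG.
have hu (u : R^o -> 'rV[R]_r) i : differentiable u 0 ->
    is_derive (0 : R^o) (1 : R^o) (fun t => u t 0 i : R^o) (('D_1 u 0) 0 i).
  move=> du; rewrite derive_coord//; apply: derivableP.
  by apply: diff_derivable; exact: differentiable_row_coord.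
have key (w1 w2 : R^o -> 'rV[R]_r) : differentiable w1 0 -> differentiable w2 0 ->
    is_derive (0 : R^o) (1 : R^o) (fun t => vgram (z + t *: v) (w1 t) (w2 t) : R^o)
    (\sum_i \sum_j (w1 0 0 i * (w2 0 0 j * dm i j) + ('D_1 w1 0) 0 i * (w2 0 0 j * m i j 0)
      + w1 0 0 i * (('D_1 w2 0) 0 j * m i j 0))).
  move=> dw1 dw2.
  have T := is_derive_trilinear_sum (fun i => hu w1 i dw1) (fun i => hu w2 i dw2) hm.
  apply: near_eq_is_derive T.
  by apply: filterS (open_nbhs_nbhs (conj oI I0)) => t It; rewrite (vgram_expand _ _ (kI t It)).
apply: (is_derive_eq (key u1 u2 d1 d2)).
have Em i j : m i j 0 = vgram z (delta_mx 0 i) (delta_mx 0 j).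
  by rewrite /m scale0r addr0.
rewrite (vgram_expand ('D_1 u1 0))// (vgram_expand (u1 0))//.
have -> : 'D_v (gram B G k (row_mx 0 (u1 0)) (row_mx 0 (u2 0))) z =
    \sum_i \sum_j u1 0 0 i * (u2 0 0 j * dm i j).
  rewrite derive_line.
  have [_ ->] := key (cst (u1 0)) (cst (u2 0)) (differentiable_cst _ _) (differentiable_cst _ _).
  apply: eq_bigr => i _; apply: eq_bigr => j _.
  by rewrite !derive_cst !mxE !mul0r mulr0 !addr0.
rewrite -!big_split /=; apply: eq_bigr => i _.
rewrite -!big_split /=; apply: eq_bigr => j _.
by rewrite !Em.
Qed.

(** Let P_t be parallel transport along x0 + t xi, in fiber coordinates, and L
   its derivative at t = 0. L is linear because each P_t is. The lifts are
   horizontal, so (xi, L eta) is a horizontal vector at (x0, eta). Finally the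
   fiber metric of P_t alpha and P_t beta does not depend on t, and its
   derivative at 0 is the last identity. *)
Lemma transport_coords x0 xi :
  bc_base c U x0 -> exists L : 'rV[R]_r -> 'rV[R]_r, [/\ linear L,
   forall eta, let e := cbwd k (row_mx x0 eta) in
     D e (coordvec B k e (row_mx xi (L eta))) &
   forall y0 alpha beta, (forall a b, differentiable (gram B G k a b) (row_mx x0 y0)) ->
     'D_(row_mx xi 0) (gram B G k (row_mx 0 alpha) (row_mx 0 beta)) (row_mx x0 y0)
     + vgram (row_mx x0 y0) (L alpha) beta + vgram (row_mx x0 y0) alpha (L beta) = 0].
Proof.
move=> Ox0.
have [I [tau [oI tau0 Itau IO sg]]] := coordinate_line xi (bc_atlas bc) (bc_open bc) Ox0.
pose gam (t : R) := cbwd c (x0 + t *: xi).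
have I0 : I 0 by apply: Itau; rewrite lexx ltW.
have Vg t : I t -> V (gam t) /\ cfwd c (gam t) = x0 + t *: xi.
  move=> /IO[q [cq Uq] E]; rewrite /gam -E chartK//.
have [V0 c0] := Vg 0 I0.
rewrite scale0r addr0 in c0.
have lPhi t : I t -> linear (@Phi (gam t)) by move=> /Vg[[_ /(bc_linear bc)]].
have [_ trans] := bD.
have [P0 [pt0 _]] := trans gam 0 tau tau0 (sg _ (lexx _)).
have /choice[S HS] : forall x : F (gam 0), exists s : forall t, F (gam t),
    horizontal_lift B D 0 tau s /\ s 0 = x.
  by move=> x; have [s [hs s0 _]] := pt0 x; exists s.
(* The lifts over [0, tau], restricted to [0, t], exhibit evaluation at time t
   as a parallel transport; by uniqueness it is the linear one. *)
have ptS t : 0 < t <= tau -> @parallel_transport _ _ _ _ _ B D gam 0 t (fun x => S x t).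
  move=> /andP[t0 tt] x; exists (S x); have [hs s0] := HS x; split=> //.
  exact: horizontal_lift_sub tt hs.
have linS t : 0 < t <= tau -> linear (fun x => S x t).
  move=> /[dup] ht /andP[t0 tt]; have [P [ptP lP]] := trans gam 0 t t0 (sg _ tt).
  by rewrite (transport_unique met t0 (sg _ tt) (ptS t ht) ptP).
have kS x t : I t -> cdom k (bpt (S x t)) by move=> /Vg[Vt _]; exact/(bc_domP bc).
have fS x t : I t -> cfwd k (bpt (S x t)) = row_mx (x0 + t *: xi) (Phi (S x t)).
  by move=> /Vg[Vt ct]; rewrite (bc_fwd bc)// ct.
pose w x (t : R^o) := cfwd k (bpt (S x t)).
have dw x : differentiable (w x) 0.
  have [[[I' [oI' I'0 sI']] _] _] := HS x.
  have I'00 : I' 0 by apply: I'0; rewrite lexx ltW.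
  have [J [oJ J0 _ sJ]] := smooth_into_chart ak sI' I'00 (kS x 0 I0).
  exact: smooth_on_differentiable sJ J0.
pose y x (t : R^o) : 'rV[R]_r := rsubmx (w x t).
have yE x t : I t -> y x t = Phi (S x t) by move=> It; rewrite /y /w fS// row_mxKr.
have dy x : differentiable (y x) 0.
  apply: (@differentiable_comp _ _ _ _ (w x) rsubmx) => //; exact: differentiable_rsubmx.
have Dw x : 'D_(1 : R^o) (w x) 0 = row_mx xi ('D_(1 : R^o) (y x) 0).
  rewrite -[LHS]hsubmxK; congr row_mx.
    transitivity ('D_(1 : R^o) (lsubmx \o w x : R^o -> 'rV[R]_n) 0).
      rewrite (@derive_comp _ _ _ _ (w x) lsubmx)//; last exact: differentiable_lsubmx.
      rewrite [RHS]deriveE; last exact: differentiable_lsubmx.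
      by rewrite diff_lin//; exact: continuous_lsubmx.
    have [_ <-] := is_derive_line x0 xi 0.
    apply: near_eq_derive; apply: filterS (open_nbhs_nbhs (conj oI I0)) => t It.
    by rewrite /= /w fS// row_mxKl.
  rewrite (@derive_comp _ _ _ _ (w x) rsubmx)//; last exact: differentiable_rsubmx.
  rewrite [RHS]deriveE; last exact: differentiable_rsubmx.
  by rewrite diff_lin//; exact: continuous_rsubmx.
(* At t = 0 the lift starts at x; for t > 0 this is linearity of the
   transport. *)
have yl t s x x' : 0 <= t <= tau -> y (s *: x + x') t = s *: y x t + y x' t.
  move=> /[dup] ht /andP[t0 tt]; have It := Itau t ht.
  rewrite !yE//; move: t0; rewrite le_eqVlt => /orP[/eqP<-|t0].
    by rewrite (HS _).2 (HS x).2 (HS x').2 lPhi.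
  by rewrite linS ?t0// lPhi.
have y0E x : y x 0 = Phi x by rewrite yE// (HS x).2.
have [gi giK Kgi] := bc_bij bc V0.2.
exists (fun eta => 'D_(1 : R^o) (y (gi eta)) 0); split.
- move=> s a b.
  have -> : gi (s *: a + b) = s *: gi a + gi b.
    by apply: (can_inj giK); rewrite (lPhi 0 I0) !Kgi.
  apply/eqP; rewrite -subr_eq0; apply/eqP.
  pose f (t : R^o) := y (s *: gi a + gi b) t - (s *: y (gi a) t + y (gi b) t).
  have df1 : differentiable (fun t : R^o => s *: y (gi a) t + y (gi b) t) 0.
    by apply: differentiableD => //; exact: differentiableZ.
  have df : differentiable f 0 by exact: differentiableB.
  rewrite -(derive_right0 tau0 df); last by move=> t ht; rewrite /f yl// subrr.
  rewrite (@deriveB _ _ _ (y (s *: gi a + gi b)) (fun t : R^o => s *: y (gi a) t + y (gi b) t));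
    [|exact: diff_derivable..].
  rewrite (@deriveD _ _ _ (fun t : R^o => s *: y (gi a) t) (y (gi b)));
    [|by apply: diff_derivable; exact: differentiableZ|exact: diff_derivable].
  by rewrite (@deriveZ _ _ _ (y (gi a)))//; exact: diff_derivable.
- move=> eta /=; have := (HS (gi eta)).1.2 0; rewrite lexx ltW// => /(_ isT).
  rewrite (velocity_coordvec ak oI I0 (kS _) (dw _)) Dw.
  suff -> : bpt (S (gi eta) 0) = cbwd k (row_mx x0 eta) by [].
  rewrite -[LHS](chartK (kS _ _ I0)) fS// (HS _).2 Kgi scale0r addr0.
  by [].
- move=> y0 alpha beta dG; set z := row_mx x0 y0 in dG *; set v := row_mx xi 0.
  have lz (t : R^o) : lsubmx (z + t *: v) = x0 + t *: xi.
    by rewrite linearD linearZ /= !row_mxKl.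
  have kI t : I t -> cimg k (z + t *: v).
    by move=> It; apply/(bc_cimgP bc); rewrite lz; exact: IO.
  have key := derive_vgram_along oI I0 kI dG (dy (gi alpha)) (dy (gi beta)).
  rewrite !y0E !Kgi in key; have [dk <-] := key.
  pose C := vgram z alpha beta.
  pose f (t : R^o) : R^o := vgram (z + t *: v) (y (gi alpha) t) (y (gi beta) t) - C.
  have df : differentiable f 0.
    by apply: differentiableB => //; exact/derivable1_diffP.
  rewrite -(derive_subr_cst C dk).
  apply: (derive_right0 tau0 df) => t ht.
  have It := Itau t ht; have [Vt ct] := Vg t It.
  apply/eqP; rewrite subr_eq0; apply/eqP; rewrite /C !yE//.
  set x1 := gi alpha; set x2 := gi beta.
  (* The fiber metric may be evaluated at any point of the fiber, in particular
     at the lift of x1 itself. *)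
  rewrite (vgram_fiber vb ti tG bc (z' := cfwd k (bpt (S x1 t))))//; last 2 first.
  + exact: kI.
  + by rewrite lz fS// row_mxKl.
  rewrite (vgram_h vb tG bc)//.
  rewrite (vgram_fiber vb ti tG bc (z := z) (z' := cfwd k (bpt (S x1 0)))); last 2 first.
  + by have := kI 0 I0; rewrite scale0r addr0.
  + by rewrite fS// row_mxKl row_mxKl scale0r addr0.
  rewrite -(Kgi alpha) -(Kgi beta) -/x1 -/x2 (vgram_h vb tG bc)//.
  move: ht => /andP[]; rewrite le_eqVlt => /orP[/eqP <- _|t0 tt].
    by rewrite (HS x1).2 (HS x2).2.
  have ht : 0 < t <= tau by rewrite t0.
  rewrite (transport_isometry x1 x1 x2 met t0 (sg _ tt) (ptS t ht) (linS t ht)).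
  by rewrite (HS x1).2.
Qed.

End Metric.

(** * The covariant derivative along the fibers *)

Section Main.
Context {R : realType} {M : Type} {n r : nat} {F : M -> lmodType R}.
Context (A : manifold R M n) (B : manifold R (totsp F) (n + r)).
Variables (D : totsp F -> set (tvec R (totsp F)))
    (h : totsp F -> tvec R (totsp F) -> tvec R (totsp F) -> R)
    (g : M -> tvec R M -> tvec R M -> R)
    (G : totsp F -> tvec R (totsp F) -> tvec R (totsp F) -> R)
    (nab : totsp F -> tvec R (totsp F) -> (totsp F -> tvec R (totsp F)) ->
             tvec R (totsp F)).
Hypotheses (vb : vector_bundle A B) (bD : bundle_connection A B D)
  (ti : translation_invariant_metric A B h) (tG : total_metric A B g h D G)
  (LC : levi_civita B G nab).

Let pG : pseudo_riemannian B G. Proof. by case: tG. Qed.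

Section Chart.
Variables (c : chart R M n) (U : set M) (Phi : forall q, F q -> 'rV[R]_r)
  (k : chart R (totsp F) (n + r)).
Hypothesis bc : bundle_chart A B c U Phi k.

Let ak := bc_adapted bc.

Notation vgram z alpha beta := (gram B G k (row_mx 0 alpha) (row_mx 0 beta) z).

(** The horizontal vector (xi, L y) at height y shows that the product of (xi,
   0) with a vertical vector b is minus the fiber product of L y and b. This is
   affine in y because L is linear and the fiber metric is constant along the
   fiber. *)
Lemma derive_mixed_gram z L a b xi : cimg k z -> linear L ->
  (forall eta, let e := cbwd k (row_mx (lsubmx z) eta) in
     D e (coordvec B k e (row_mx xi (L eta)))) ->
  'D_(row_mx 0 a) (gram B G k (row_mx 0 b) (row_mx xi 0)) z = - vgram z b (L a).
Proof.
move=> kz lL HD; rewrite derive_line.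
have lz (t : R^o) : lsubmx (z + t *: row_mx 0 a) = lsubmx z.
  by rewrite linearD linearZ /= row_mxKl scaler0 addr0.
have kt t : cimg k (z + t *: row_mx 0 a).
  by apply/(bc_cimgP bc); rewrite lz; apply/(bc_cimgP bc).
(* (xi, 0) = (xi, L y) - (0, L y) at height y = y0 + t a. *)
pose y0 : 'rV[R]_r := rsubmx z.
have rz (t : R^o) : z + t *: row_mx 0 a = row_mx (lsubmx z) (y0 + t *: a).
  by rewrite -{1}(hsubmxK z) scale_row_mx scaler0 add_row_mx addr0.
have E : (fun t : R^o => gram B G k (row_mx 0 b) (row_mx xi 0) (z + t *: row_mx 0 a)) =
    (fun t : R^o => - vgram z b (L y0) + t *: (- vgram z b (L a) : R^o)).
  apply/funext => t; have kzt := kt t; have ke := cdom_bwd kzt.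
  rewrite (gramC pG ak)//.
  have -> : row_mx xi (0 : 'rV[R]_r) =
      (-1) *: row_mx 0 (L (y0 + t *: a)) + row_mx xi (L (y0 + t *: a)).
    by rewrite scale_row_mx add_row_mx scaler0 add0r scaleN1r addNr.
  rewrite (gram_linear pG ak)//.
  have -> : gram B G k (row_mx xi (L (y0 + t *: a))) (row_mx 0 b) (z + t *: row_mx 0 a) = 0.
    rewrite /gram; apply: (total_metric_orth tG); first by rewrite rz; exact: HD.
    exact: (vertical_coordvec vb bc).
  rewrite addr0 (vgram_fiber vb ti tG bc _ _ kzt (lz t)).
  rewrite [y0 + _]addrC lL (vgram_linear tG bc _ kz) (vgramC tG bc (L y0))//.
  by rewrite (vgramC tG bc (L a))// /GRing.scale /=; ring.
rewrite E; have [_ ->] := @is_derive_line R R^o (- vgram z b (L y0)) (- vgram z b (L a)) 0.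
by [].
Qed.

(** In Koszul's formula for a, b vertical and (xi, 0), the first two terms are -
   h(b, L a) and - h(a, L b) by [derive_mixed_gram]; the last one, the
   derivative of h(a, b) in the direction xi, cancels them by the isometry
   identity of [transport_coords]. *)
Lemma nab_metric_orth e (Y : 'rV[R]_(n + r) -> totsp F -> tvec R (totsp F)) a b xi :
  metric_connection A B D h -> cdom k e ->
  (forall b c, differentiable (gram B G k b c) (cfwd k e)) ->
  (forall a b c, 2 * G e (nab e (coordvec B k e a) (Y b)) (coordvec B k e c) =
      'D_a (gram B G k b c) (cfwd k e) + 'D_b (gram B G k a c) (cfwd k e)
      - 'D_c (gram B G k a b) (cfwd k e)) ->
  G e (nab e (coordvec B k e (row_mx 0 a)) (Y (row_mx 0 b))) (coordvec B k e (row_mx xi 0)) = 0.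
Proof.
move=> met ke dG kos; have kz := cimg_fwd ke; set z := cfwd k e in kz dG kos *.
have Oz : bc_base c U (lsubmx z) by apply/(bc_cimgP bc).
have [L [lL HD HI]] := transport_coords vb bD ti tG met bc xi Oz.
have := kos (row_mx 0 a) (row_mx 0 b) (row_mx xi 0).
rewrite !(derive_mixed_gram _ _ kz lL HD).
have := HI (rsubmx z) a b; rewrite hsubmxK => /(_ dG).
rewrite (vgramC tG bc (L a))// => H1 H2.
by move: H1 H2; lra.
Qed.

End Chart.

Lemma nab_translation_horizontal w e v : smooth_section A B w -> vertical A B e v ->
  D e (nab e v (translation_field B w)).
Proof.
move=> sw; have [c [U [Phi [k [bc ke]]]]] := bundle_chart_at e vb.
move=> /(verticalP vb bc _ ke)[alpha ->].
have [Y [J [[oJ Jp JO sY EY] dG kos]]] := koszul_coordinates pG LC (bc_adapted bc) ke.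
have [beta ->] := nab_translation_field vb LC bc alpha ke oJ Jp JO sY EY sw.
exact: (nab_vertical_horizontal vb bD.1 ti tG LC bc ke sY kos).
Qed.

(** The derivative is orthogonal to the vertical vectors and to the coordinate
   vectors (xi, 0). Together they span the tangent space, and the total metric
   is nondegenerate. *)
Lemma nab_translation_metric w e v : metric_connection A B D h ->
  smooth_section A B w -> vertical A B e v -> nab e v (translation_field B w) = 0.
Proof.
move=> met sw; have [c [U [Phi [k [bc ke]]]]] := bundle_chart_at e vb.
move=> /(verticalP vb bc _ ke)[alpha ->].
have ak := bc_adapted bc.
have [Y [J [[oJ Jp JO sY EY] dG kos]]] := koszul_coordinates pG LC ak ke.
have [beta ->] := nab_translation_field vb LC bc alpha ke oJ Jp JO sY EY sw.
have T a : tangent_space B e (coordvec B k e a) by exact: coordvec_tangent.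
have Tn := nab_tangent LC (T (row_mx 0 alpha)) (sY (row_mx 0 beta)).
have [_ _ nd _] := pG; apply: (nd e) => // y /(tangent_coordvec ak ke)[a ->].
rewrite (metricC pG Tn (T a)) -(hsubmxK a).
have -> : row_mx (lsubmx a) (rsubmx a) = row_mx (lsubmx a) 0 + row_mx 0 (rsubmx a).
  by rewrite add_row_mx addr0 add0r.
rewrite coordvecD// (metricD pG (T _) (T _) Tn) !(metricC pG (T _) Tn).
rewrite (nab_metric_orth bc alpha beta _ met ke dG kos) add0r.
by apply: (nab_vertical_orth vb ti tG bc ke kos); exact: (vertical_coordvec vb bc).
Qed.

End Main.

Theorem theorem2p15 (R : realType) (M : Type) (n r : nat) (F : M -> lmodType R)
    (A : manifold R M n) (B : manifold R (totsp F) (n + r))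
    (D : totsp F -> set (tvec R (totsp F)))
    (h : totsp F -> tvec R (totsp F) -> tvec R (totsp F) -> R)
    (g : M -> tvec R M -> tvec R M -> R)
    (G : totsp F -> tvec R (totsp F) -> tvec R (totsp F) -> R)
    (nabla : totsp F -> tvec R (totsp F) -> (totsp F -> tvec R (totsp F)) ->
             tvec R (totsp F)) :
  vector_bundle A B ->
  bundle_connection A B D ->
  translation_invariant_metric A B h ->
  pseudo_riemannian A g ->
  total_metric A B g h D G ->
  levi_civita B G nabla ->
  (forall (W : totsp F -> tvec R (totsp F)) (e : totsp F)
          (v : tvec R (totsp F)),
     translation_invariant_field A B W -> vertical A B e v ->
     D e (nabla e v W)) /\
  (metric_connection A B D h ->
   forall (W : totsp F -> tvec R (totsp F)) (e : totsp F)
          (v : tvec R (totsp F)),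
     translation_invariant_field A B W -> vertical A B e v ->
     nabla e v W = 0).
Proof.
move=> vb bD ti _ tG LC; split=> [W e v [w sw ->] Vv|met W e v [w sw ->] Vv].
  exact: (nab_translation_horizontal vb bD ti tG LC sw Vv).
exact: (nab_translation_metric vb bD ti tG LC met sw Vv).
Qed.
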